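(* The one-dimensional Minkowski contents of $H_m$ and $G_m$ exist in $[0,\infty]$ for every $m\ge 1$, and $$\mathcal{M}^1(H_1)=\mathcal{M}^1(G_1)=4\pi\log(1+\sqrt{2}),$$ while for every integer $m\geq2$, $$\mathcal{M}^1(H_m)=\mathcal{M}^1(G_m)=\infty.$$
   Context: Let $\mathbb{Z}[i]=\{a+bi:a,b\in\mathbb{Z}\}$ and $Q=\{z\in\mathbb{C}:-\tfrac12\leq\operatorname{Re}z<\tfrac12,\ -\tfrac12\leq\operatorname{Im}z<\tfrac12\}$. For $w\in\mathbb{C}$ let $[w]\in\mathbb{Z}[i]$ be the unique Gaussian integer with $w-[w]\in Q$. The Hurwitz map $\mathcal{T}:Q\to Q$ is given by $\mathcal{T}(0)=0$ and $\mathcal{T}(z)=\frac1z-[\frac1z]$ for $z\in Q\setminus\{0\}$. For $z\in Q\setminus\{0\}$ put $z_0=z$ and, as long as $z_{j-1}\neq 0$, $z_j=\mathcal{T}(z_{j-1})$. For $m\ge 1$, $z$ is said to have a Hurwitz continued fraction expansion of length $m$ if $z_m=0$ and $z_j\neq0$ for $0\leq j\leq m-1$. Let $H_m$ ($m\ge1$) be the set of all $z\in Q$ having a Hurwitz continued fraction expansion of length $m$ (exactly). Define recursively $G_0=\{0\}$ and, for $m\geq1$, $G_m=\{\frac{1}{u+v}: u\in\mathbb{Z}[i],\ v\in G_{m-1},\ |u+v|>1\}$. For a non-empty bounded $\Omega\subset\mathbb{C}\cong\mathbb{R}^2$ and $r>0$, let $\Omega_r=\{y\in\mathbb{C}:|x-y|<r\text{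 for some }x\in\Omega\}$, and let $\mathcal{L}^2$ be planar Lebesgue measure. The one-dimensional Minkowski content of $\Omega$ is $\mathcal{M}^1(\Omega)=\lim_{r\to0^+}\frac{\mathcal{L}^2(\Omega_r)}{r}$, whenever this limit exists in $[0,\infty]$. *)

(* Defs.v *)
From HB Require Import structures.
From mathcomp Require Import all_boot all_order all_algebra.
From mathcomp Require Import all_classical all_reals all_analysis.
From mathcomp Require Import complex.

Set Implicit Arguments.
Unset Strict Implicit.
Unset Printing Implicit Defensive.

Import Order.TTheory GRing.Theory Num.Theory.
Import numFieldNormedType.Exports.

Local Open Scope classical_set_scope.
Local Open Scope ring_scope.
Local Open Scope complex_scope.

Section Hurwitz.
Context {R : realType}.
Implicit Types (z w : R[i]) (A : set R[i]) (r : R) (m : nat).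

Definition gaussian_integers : set R[i] :=
  [set z | exists a b : int, z = a%:~R +i* b%:~R].

Definition unit_square : set R[i] :=
  [set z | (- 2^-1 <= complex.Re z < 2^-1) /\ (- 2^-1 <= complex.Im z < 2^-1)].

(* The default value 0 is never used: see nearest_gaussianP. *)
Definition nearest_gaussian w : R[i] :=
  xget 0 [set u | gaussian_integers u /\ unit_square (w - u)].

Lemma nearest_gaussian_ex w :
  exists u, gaussian_integers u /\ unit_square (w - u).
Proof.
case: w => x y.
have aux (t : R) : - 2^-1 <= t - (Num.floor (t + 2^-1))%:~R < 2^-1.
  have /andP[h1 h2] := floor_itv (t + 2^-1).
  move: h2; rewrite intrD /= => h2.
  rewrite lerBrDr addrC lerBlDr h1 ltrBlDr /=.
  rewrite -(ltrD2r 2^-1) (lt_le_trans h2)// addrAC -[leRHS]addrC lerD2l.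
  by rewrite -div1r -splitr.
exists ((Num.floor (x + 2^-1))%:~R +i* (Num.floor (y + 2^-1))%:~R); split.
  by do 2 eexists.
by split; exact: aux.
Qed.

Lemma nearest_gaussian_uniq w u v :
  gaussian_integers u -> unit_square (w - u) ->
  gaussian_integers v -> unit_square (w - v) -> u = v.
Proof.
have aux (t : R) (a b : int) : - 2^-1 <= t - a%:~R < 2^-1 ->
    - 2^-1 <= t - b%:~R < 2^-1 -> a = b.
  move=> ha hb.
  have E (c : int) : - 2^-1 <= t - c%:~R < 2^-1 -> Num.floor (t + 2^-1) = c.
    move=> /andP[h1 h2]; apply: floor_def; rewrite intrD /=; apply/andP; split.
      by move: h1; rewrite lerBrDr addrC lerBlDr.
    move: h2; rewrite ltrBlDr -(ltrD2r 2^-1) => /lt_le_trans; apply.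
    by rewrite addrAC -div1r -splitr addrC.
  by rewrite -(E a ha) -(E b hb).
case: w => x y [a [b ->]] [/= ha hb] [c [d ->]] [/= hc hd].
by rewrite (aux x a c)// (aux y b d).
Qed.

Lemma nearest_gaussianP w :
  gaussian_integers (nearest_gaussian w) /\
  unit_square (w - nearest_gaussian w).
Proof. exact: (xgetPex 0 (nearest_gaussian_ex w)). Qed.

Definition hurwitz_map z : R[i] :=
  if z == 0 then 0 else z^-1 - nearest_gaussian z^-1.

Definition hurwitz_set m : set R[i] :=
  [set z | [/\ unit_square z, iter m hurwitz_map z = 0 &
    forall j, (j < m)%N -> iter j hurwitz_map z != 0]].

Fixpoint hurwitz_G m : set R[i] :=
  if m is m'.+1 then
    [set z | exists u v, [/\ gaussian_integers u, hurwitz_G m' v,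
                             1 < `|u + v| & z = (u + v)^-1]]
  else [set 0].

Definition planar_lebesgue A : \bar R :=
  (lebesgue_measure \x lebesgue_measure)%E
    [set p : measurableTypeR R * measurableTypeR R | A (p.1 +i* p.2)].

(* `|x - y| lives in R[i], hence the injection of r. *)
Definition neighborhood A r : set R[i] :=
  [set y | exists2 x, A x & `|x - y| < r%:C].

Definition minkowski_ratio A r : \bar R :=
  (planar_lebesgue (neighborhood A r) * (r^-1)%:E)%E.

Definition has_minkowski_content A : Prop :=
  exists2 l : \bar R, (0 <= l)%E & minkowski_ratio A r @[r --> 0^'+] --> l.

(* Meaningful only under has_minkowski_content. *)
Definition minkowski_content A : \bar R :=
  lim (minkowski_ratio A r @[r --> 0^'+]).

End Hurwitz.

(* Main.v *)
Require Import Defs.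
From HB Require Import structures.
From mathcomp Require Import all_boot all_order all_algebra.
From mathcomp Require Import all_classical all_reals all_analysis.
From mathcomp Require Import complex.
From mathcomp Require Import measurable_realfun.
From mathcomp Require Import ring lra.

(** Inversion w = 1/z turns planar measure into |w|^-4 dw. The point 1/w lies
within r of some 1/u, u a Gaussian integer, roughly when the Gaussian integer
nearest to w is at distance less than r|w|^2. Inside one unit cell of the lattice
|w| varies by a factor close to 1 once w is large, so the offset p of w from the
centre of its cell may be averaged out independently of w: up to factors tending
to 1, the measure of the r-neighbourhood of { 1/u } is
  int_{p in Q} int_{|w|^2 > |p|/r} |w|^-4 dw dp = pi r int_{p in Q} dp / |p|
                                               = 4 pi ln (1 + sqrt 2) r.
Both H_1 and G_1 differ from { 1/u : |u| >= 3 } by finitely many points, which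
contribute O(r^2).

For m = 2 the sets contain all 1/(u + v) with |u| >= 4 and v = 1/u', |u'| >= 3.
Every point of a disc of radius of order r^(1/2) |u| around u is sent by inversion
into the r-neighbourhood; this gives area at least of order r |u|^-2 for each u,
and the sum of |u|^-2 diverges. Passing from m to m + 1 uses the first digit 4:
inversion after translation by 4 is bi-Lipschitz on the unit disc. *)

Set Implicit Arguments.
Unset Strict Implicit.
Unset Printing Implicit Defensive.

Import Order.TTheory GRing.Theory Num.Theory.
Import numFieldNormedType.Exports.

Local Open Scope classical_set_scope.
Local Open Scope ring_scope.

(** Every distortion at the first level is bounded by a power of [1 + h], where [h] is fixed first
    and r tends to 0 afterwards. Once |w| exceeds a multiple of 1/h, moving inside a cell changes
    |w| by a factor of at most 1 + h. The bounded region that remains is harmless: in the upper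
    bound it is avoided by setting finitely many points aside; in the lower bound only offsets p of
    order r meet it, since |p| < r|w|^2 forces |w| to be large for all the others. The logarithm
    comes from cutting the square along its diagonals: slopes in [-1, 1] give the integral of (1 +
    t^2)^(-1/2), and the steeper ones give the same through t -> 1/t. At level 2 the radius
    r^(1/2)|u| has this origin: a point at distance t from 0 is within order t^2 of some 1/u', and
    inversion near u multiplies distances by |u|^-2, so that t^2 may be of order r|u|^2. The discs
    must stay inside their cells, which limits |u| to order r^(-1/2). The divergence is logarithmic,
    and for each target constant finitely many annuli suffice, uniformly for small r. *)

Lemma image_measure_ex d1 d2 (X : measurableType d1) (Y : measurableType d2)
    (R : realType) (m : {measure set X -> \bar R}) (phi : X -> Y) :
  measurable_fun setT phi ->
  exists m' : {measure set Y -> \bar R}, m' = pushforward m phi :> (set Y -> \bar R).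
Proof.
by move=> mphi; exists (measure_function_pushforward__canonical__measure_function_Measure m mphi).
Qed.

(** * Changes of variables on the line *)

Section real_line.
Context {R : realType}.
Local Notation leb := (@lebesgue_measure R).

Lemma lebesgue_measure_scale (c : R) (A : set R) : c != 0 -> measurable A ->
  (`|c|%:E * leb ( *%R c @^-1` A))%E = leb A.
Proof.
move=> c0 mA; have mc : measurable_fun setT ( *%R c : R -> measurableTypeR R).
  exact: measurable_funM.
have [m mE] := image_measure_ex leb mc.
have sE B : mscale (NngNum (normr_ge0 c)) m B = (`|c|%:E * leb ( *%R c @^-1` B))%E.
  by rewrite /mscale/= mE.
rewrite -sE; apply/esym/lebesgue_measure_unique => // _ [[a b]] _ <-.
apply/esym/(etrans (sE _)) => /=.
have [c1|c1] := ltP 0 c.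
  have -> : *%R c @^-1` `]a, b] = `](a / c), (b / c)]%classic.
    apply/seteqP; split => x /=; rewrite !in_itv/= ltr_pdivrMr// ler_pdivlMr// !(mulrC x)//.
  rewrite !lebesgue_measure_itv/= !lte_fin ltr_pM2r ?invr_gt0//.
  case: ifPn => // _; last by rewrite mule0.
  by rewrite -!EFinD -EFinM gtr0_norm// -mulrBl mulrC divfK// gt_eqF.
have {}c1 : c < 0 by rewrite lt_neqAle c0.
have -> : *%R c @^-1` `]a, b] = `[(b / c), (a / c)[%classic.
  by apply/seteqP; split => x /=; rewrite !in_itv/= ltr_ndivlMr// ler_ndivrMr// !(mulrC x) andbC.
rewrite !lebesgue_measure_itv/= !lte_fin ltr_nM2r ?invr_lt0//.
case: ifPn => // _; last by rewrite mule0.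
by rewrite -!EFinD -EFinM ltr0_norm// -mulrBl mulrC mulrN divfK// ?lt_eqF// opprB.
Qed.

Lemma integral_scale (c : R) (f : R -> \bar R) : c != 0 ->
  measurable_fun setT f -> (forall x, 0 <= f x)%E ->
  (`|c|%:E * \int[leb]_x f (c * x)%R = \int[leb]_x f x)%E.
Proof.
move=> c0 mf f0.
have mc : measurable_fun setT ( *%R c : _ -> measurableTypeR R).
  exact: measurable_funM.
transitivity (`|c|%:E * \int[pushforward leb ( *%R c : _ -> measurableTypeR R)]_x f x)%E.
  by rewrite ge0_integral_pushforward.
have [m mE] := image_measure_ex leb mc.
rewrite -mE -[LHS](ge0_integral_mscale m measurableT (NngNum (normr_ge0 c)))//.
apply: eq_measure_integral => A mA _.
rewrite -[RHS](lebesgue_measure_scale c0 mA).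
by rewrite -[LHS]/(`|c|%:E * m A)%E mE.
Qed.

Lemma lebesgue_measure_translate (a : R) (A : set R) : measurable A ->
  pushforward leb (+%R a : _ -> measurableTypeR R) A = leb A.
Proof.
move=> mA; apply/esym/lebesgue_measure_unique => //=.
  exact: measurable_funD.
move=> mc _ [[x y]] _ <-.
rewrite /pushforward.
have -> : +%R a @^-1` `]x, y] = `](x - a), (y - a)]%classic.
  by apply/seteqP; split => z /=; rewrite !in_itv/= ltrBlDl lerBrDl.
rewrite !lebesgue_measure_itv/= !lte_fin ltrD2r; case: ifPn => // _.
by rewrite -!EFinD; congr EFin; ring.
Qed.

End real_line.

Section measurability.
Context {R : realType}.
Local Notation leb := (@lebesgue_measure R).

Lemma measurable_invr : measurable_fun setT (@GRing.inv R).
Proof.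
have -> : [set: R] = [set 0] `|` ~` [set 0] by rewrite setUv.
apply/measurable_funU => //; first exact/measurableC.
split; first exact: measurable_fun_set1.
apply: open_continuous_measurable_fun.
  exact/closed_openC/accessible_closed_set1/hausdorff_accessible/Rhausdorff.
by move=> x; rewrite inE/= => /eqP x0; exact: inv_continuous.
Qed.

Lemma measurable_funV d (T : measurableType d) (f : T -> R) :
  measurable_fun setT f -> measurable_fun setT (fun x => (f x)^-1).
Proof. by move=> mf; exact: (measurableT_comp measurable_invr). Qed.

Lemma measurable_funEFin d (T : measurableType d) (f : T -> R) :
  measurable_fun setT f -> measurable_fun setT (fun x => (f x)%:E).
Proof. by move=> mf; exact/measurable_EFinP. Qed.

Lemma measurable_funoppr d (T : measurableType d) (f : T -> R) :
  measurable_fun setT f -> measurable_fun setT (fun x => - f x).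
Proof. exact: measurable_funN. Qed.

(** Removes the null set {0}, where inverses take their default value, from pointwise identities. *)
Lemma eq_integral_neq0 (f g : R -> \bar R) :
  measurable_fun setT f -> measurable_fun setT g ->
  (forall x, x != 0 -> f x = g x) ->
  (\int[leb]_x f x = \int[leb]_x g x)%E.
Proof.
move=> mf mg fg.
have mD : measurable ([set: R] `\ 0) by apply: measurableD.
apply: (etrans (esym (integral_setD1 mD (measurable_funS _ _ mf)))) => //.
apply: (etrans _ (integral_setD1 mD (measurable_funS _ _ mg))) => //.
by apply: eq_integral => x; rewrite inE => -[_ /eqP x0]; exact: fg.
Qed.

End measurability.

Ltac meas1 := first [ assumption | exact: measurable_fst | exact: measurable_snd
  | exact: measurable_cst | exact: measurable_id
  | apply: measurable_funEFin | apply: measurable_funM | apply: measurable_funD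
  | apply: measurable_funB | apply: measurable_funoppr | apply: measurable_funV
  | apply: measurable_funX
  | apply: (measurableT_comp (@normr_measurable _ setT)) ].
Ltac meas := do ?meas1; try by do ?[exact: measurableT_comp | meas1].

(** * Invariance of dx/|x| under dilations and inversion *)

Section dilations.
Context {R : realType}.
Local Notation leb := (@lebesgue_measure R).

(** The measure dx/|x| is the Haar measure of the multiplicative group of nonzero reals. *)
Lemma haar_scale (c : R) (f : R -> R) : c != 0 -> measurable_fun setT f ->
  (forall x, 0 <= f x) ->
  (\int[leb]_x (f (c * x)%R * `|x|^-1)%:E = \int[leb]_x (f x * `|x|^-1)%:E)%E.
Proof.
move=> c0 mf f0.
have mfc : measurable_fun setT (fun x => f (c * x)).
  by apply: (measurableT_comp mf); meas.
pose g x : \bar R := (f x * `|x|^-1)%:E.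
have g0 x : (0 <= g x)%E by rewrite lee_fin mulr_ge0// invr_ge0.
have mg : measurable_fun setT g by meas.
rewrite -[RHS](integral_scale c0)// -ge0_integralZl_EFin//=; last first.
  by apply: (measurableT_comp mg); meas.
  by move=> x _; exact: g0.
apply: eq_integral => x _; rewrite -EFinM; congr EFin.
by rewrite normrM invfM mulrCA mulVKf// normr_eq0.
Qed.

End dilations.

Section reciprocal.
Context {R : realType}.
Local Notation leb := (@lebesgue_measure R).

(* Uniqueness of Haar measure: with psi the indicator of [1, 2], Fubini and
   invariance under dilations give
   (int f(x) dx/|x|) (int psi dx/|x|) = (int f(1/x) dx/|x|) (int psi dx/|x|). *)
Lemma haar_inv (f : R -> R) : measurable_fun setT f ->
  (forall x, 0 <= f x) ->
  (\int[leb]_x (f x * `|x|^-1)%:E = \int[leb]_x (f x^-1 * `|x|^-1)%:E)%E.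
Proof.
move=> mf f0.
pose psi : R -> R := \1_(`[1, 2]%classic).
have psi0 x : 0 <= psi x by rewrite /psi indicE.
have mpsi : measurable_fun setT psi by exact: measurable_indic.
pose B : \bar R := (\int[leb]_x (psi x * `|x|^-1)%:E)%E.
have I12 : (\int[leb]_x (psi x)%:E = 1)%E.
  rewrite integral_indic// setIT/= lebesgue_measure_itv/= lte_fin ltr1n.
  by rewrite -EFinB; congr EFin; ring.
(* [B] will be cancelled from both sides, so it must be finite and positive; on [1, 2] the weight
   1/|x| lies between 1/2 and 1. *)
have B1 : (B <= 1)%E.
  rewrite -I12; apply: ge0_le_integral => //.
  - by move=> x _; rewrite lee_fin mulr_ge0// invr_ge0.
  - meas.
  - meas.
  - move=> x _; rewrite lee_fin /psi indicE; case: (boolP (x \in _)).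
      rewrite inE/= in_itv/= => /andP[x1 _]; rewrite mul1r invf_le1.
        by rewrite ger0_norm// (le_trans _ x1).
      by rewrite normr_gt0 gt_eqF// (lt_le_trans _ x1).
    by rewrite mul0r.
have B2 : (2^-1%:E <= B)%E.
  rewrite -[leLHS]mule1 -I12 -ge0_integralZl_EFin//; last 2 first.
  - by move=> x _; rewrite lee_fin.
  - meas.
  apply: ge0_le_integral => //.
  - by move=> x _; rewrite lee_fin mulr_ge0.
  - meas.
  - meas.
  - move=> x _; rewrite lee_fin /psi indicE; case: (boolP (x \in _)).
      rewrite inE/= in_itv/= => /andP[x1 x2]; rewrite mul1r mulr1.
      have x0 : 0 < x by rewrite (lt_le_trans _ x1).
      by rewrite lef_pV2 ?posrE// ?normr_gt0 ?gt_eqF// gtr0_norm.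
    by rewrite mul0r mulr0.
have B0 : (0 < B)%E by apply: lt_le_trans B2; rewrite lte_fin.
have Bfin : B \is a fin_num.
  by rewrite ge0_fin_numE ?(ltW B0)// (le_lt_trans B1)// ltry.
have inj (x y : \bar R) : (x * B = y * B)%E -> x = y.
  move=> E; apply/eqP; rewrite eq_le -(lee_pmul2r Bfin B0 x).
  by rewrite -(lee_pmul2r Bfin B0 y) E lexx.
have w0 (x : R) : 0 <= `|x|^-1 by rewrite invr_ge0.
have HB (g : R -> R) : measurable_fun setT g -> (forall x, 0 <= g x) ->
  (\int[leb]_x (g x * `|x|^-1)%:E * B =
   \int[leb]_x \int[leb]_y ((g x * `|x|^-1) * (psi y * `|y|^-1))%:E)%E.
  move=> mg g0; rewrite -ge0_integralZr//; last 3 first.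
  - meas.
  - by move=> x _; rewrite lee_fin mulr_ge0// invr_ge0.
  - exact: ltW.
  apply: eq_integral => x _; rewrite -ge0_integralZl_EFin//.
  - by move=> y _; rewrite lee_fin mulr_ge0// invr_ge0.
  - meas.
  - by rewrite mulr_ge0// invr_ge0.
(* The dilation factor [c] will be a variable of integration or its inverse. Where it is 0, the
   prefactor [k] contains the weight [0^-1 = 0] and both sides vanish. *)
have hs (k c : R) (g : R -> R) : measurable_fun setT g -> (forall x, 0 <= g x) ->
    0 <= k -> (c = 0 -> k = 0) ->
    (\int[leb]_x (k * (g (c * x)%R * `|x|^-1))%:E =
     \int[leb]_x (k * (g x * `|x|^-1))%:E)%E.
  move=> mg g0 k0 ck; have [c0|c0] := eqVneq c 0.
    by apply: eq_integral => x _; rewrite ck// !mul0r.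
  have mgc : measurable_fun setT (fun x => g (c * x)).
    by apply: (measurableT_comp mg); meas.
  under eq_integral do rewrite EFinM.
  rewrite ge0_integralZl_EFin//; last 2 first.
  - by move=> y _; rewrite lee_fin mulr_ge0.
  - meas.
  rewrite haar_scale// -ge0_integralZl_EFin//.
  - by move=> y _; rewrite lee_fin mulr_ge0.
  - meas.
have minv := @measurable_invr R.
have w00 : `|0 : R|^-1 = 0 by rewrite normr0 invr0.
have mf2 : measurable_fun setT (fun p : R * R => f (p.2^-1 * p.1)).
  by apply: (measurableT_comp mf); meas.
have mf3 : measurable_fun setT (fun p : R * R => f (p.2^-1)).
  by apply: (measurableT_comp mf); meas.
have mp3 : measurable_fun setT (fun p : R * R => psi (p.1 * p.2)).
  by apply: (measurableT_comp mpsi); meas.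
have mf1 : measurable_fun setT (fun p : R * R => f p.1).
  by apply: (measurableT_comp mf); meas.
have mp1 : measurable_fun setT (fun p : R * R => psi p.1).
  by apply: (measurableT_comp mpsi); meas.
have mp2 : measurable_fun setT (fun p : R * R => psi p.2).
  by apply: (measurableT_comp mpsi); meas.
have mfi : measurable_fun setT (fun x : R => f x^-1) by exact: (measurableT_comp mf).
have fi0 (x : R) : 0 <= f x^-1 by [].
apply: inj; rewrite (HB _ mf f0) (HB _ mfi fi0).
pose T1 (p : R * R) := ((f p.1 * `|p.1|^-1) * (psi p.2 * `|p.2|^-1))%:E.
have mT1 : measurable_fun setT T1 by rewrite /T1; meas.
have T10 p : (0 <= T1 p)%E by rewrite lee_fin !mulr_ge0.
apply: (etrans (@fubini_tonelli _ _ _ _ _ leb leb T1 mT1 T10)).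
(* From [T1] to [T2], x becomes x/y; from [T2] to [T3], y becomes xy, which leaves [f] with 1/y
   alone. A last dilation in x then frees [psi] from y. *)
pose T2 (p : R * R) := ((f (p.2^-1 * p.1) * `|p.1|^-1) * (psi p.2 * `|p.2|^-1))%:E.
transitivity (\int[leb]_y \int[leb]_x T2 (x, y))%E.
  apply: eq_integral => y _; rewrite /T1/T2/=.
  under eq_integral do rewrite mulrC.
  under [RHS]eq_integral do rewrite mulrC.
  rewrite (hs _ y^-1)// ?mulr_ge0// => /eqP; rewrite invr_eq0 => /eqP ->.
  by rewrite w00 mulr0.
have mT2 : measurable_fun setT T2 by rewrite /T2; meas.
have T20 p : (0 <= T2 p)%E by rewrite lee_fin !mulr_ge0.
apply: (etrans (esym (@fubini_tonelli _ _ _ _ _ leb leb T2 mT2 T20))).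
pose T3 (p : R * R) := ((f p.2^-1 * `|p.2|^-1) * (psi (p.1 * p.2) * `|p.1|^-1))%:E.
transitivity (\int[leb]_x \int[leb]_y T3 (x, y))%E.
  apply: eq_integral => x _; rewrite /T2/T3/=.
  have [->|x0] := eqVneq x 0.
    by under eq_integral do rewrite w00 mulr0 mul0r; under [RHS]eq_integral do rewrite w00 !mulr0.
  transitivity (\int[leb]_y (`|x|^-1 * ((psi y * f (y^-1 * x)) * `|y|^-1))%:E)%E.
    by apply: eq_integral => y _; congr EFin; ring.
  have mg : measurable_fun setT (fun y : R => psi y * f (y^-1 * x)).
    by apply: measurable_funM => //; apply: (measurableT_comp mf); meas.
  have g0 (y : R) : 0 <= psi y * f (y^-1 * x) by rewrite mulr_ge0.
  rewrite -(hs _ x _ mg g0)//; last by move/eqP; rewrite (negbTE x0).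
  apply: eq_integral => y _; congr EFin.
  have -> : (x * y)^-1 * x = y^-1 by rewrite invfM mulrAC mulVf// mul1r.
  by move: (psi _) (f _) `|y|^-1 `|x|^-1 => p q r s; rewrite mulrC [p * q]mulrC -!mulrA (mulrCA r).
have mT3 : measurable_fun setT T3 by rewrite /T3; meas.
have T30 p : (0 <= T3 p)%E by rewrite lee_fin !mulr_ge0.
apply: (etrans (@fubini_tonelli _ _ _ _ _ leb leb T3 mT3 T30)).
apply: eq_integral => y _; rewrite /T3/=.
under eq_integral do rewrite (mulrC _ y).
by rewrite hs// ?mulr_ge0// => ->; rewrite w00 mulr0.
Qed.

(* The junk value [0^-1 = 0] only matters on the null set [{0}]. *)
Lemma lebesgue_integral_inv (f : R -> R) : measurable_fun setT f ->
  (forall x, 0 <= f x) ->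
  (\int[leb]_x (f x^-1 * `|x| ^- 2)%:E = \int[leb]_x (f x)%:E)%E.
Proof.
move=> mf f0.
have := @haar_inv (fun x => f x * `|x|).
rewrite (_ : (\int[leb]_x (f x * `|x| * `|x|^-1)%:E = \int[leb]_x (f x)%:E)%E).
  move=> ->//; last 2 first.
  - meas.
  - by move=> x; rewrite mulr_ge0.
  by apply: eq_integral => x _; rewrite normfV -mulrA -expr2 exprVn.
apply: eq_integral_neq0 => [||x x0]; [by meas|by meas|].
by rewrite mulfK// normr_eq0.
Qed.

End reciprocal.

(** * Changes of variables in the plane *)

Section plane.
Context {R : realType}.
Local Notation leb := (@lebesgue_measure R).
Local Notation plane := (measurableTypeR R * measurableTypeR R)%type.
Local Notation area := (leb \x leb)%E.

(* In the coordinates (x, t = y/x), inversion acts by x |-> (1 + t^2)^-1 / x and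
   t |-> -t, so that planar changes of variables reduce to the line. *)
Lemma integral_slope (F : plane -> R) : measurable_fun setT F ->
  (forall p, 0 <= F p) ->
  (\int[area]_p (F p)%:E = \int[leb]_t \int[leb]_x (`|x| * F (x, x * t)%R)%:E)%E.
Proof.
move=> mF F0.
have mFE : measurable_fun setT (fun p => (F p)%:E) by exact: measurable_funEFin.
have FE0 p : (0 <= (F p)%:E)%E by rewrite lee_fin.
pose G (p : plane) := (`|p.1| * F (p.1, p.1 * p.2))%:E.
have mFs : measurable_fun setT (fun p : plane => F (p.1, p.1 * p.2)).
  apply: (measurableT_comp mF); apply/measurable_fun_pairP; split; rewrite /comp/=; meas.
have mG : measurable_fun setT G.
  by apply: measurable_funEFin; apply: measurable_funM => //; meas.
have G0 p : (0 <= G p)%E by rewrite lee_fin mulr_ge0.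
rewrite (fubini_tonelli1 _ mFE FE0).
apply: (etrans _ (@fubini_tonelli _ _ _ _ _ leb leb G mG G0)).
have m1 := @measurable_fun_fubini_tonelli_F _ _ _ _ _ leb _ mFE FE0.
have m2 := @measurable_fun_fubini_tonelli_F _ _ _ _ _ leb _ mG G0.
apply: eq_integral_neq0 => // x x0.
have mFx : measurable_fun setT (fun y => (F (x, y))%:E).
  by apply: measurable_funEFin; apply: (measurableT_comp mF).
rewrite /fubini_F -(integral_scale x0)//= -ge0_integralZl_EFin//=.
by apply: (measurableT_comp mFx); meas.
Qed.

Definition inversion (p : plane) : plane :=
  (p.1 / (p.1 ^+ 2 + p.2 ^+ 2), - p.2 / (p.1 ^+ 2 + p.2 ^+ 2)).

Lemma measurable_inversion : measurable_fun setT inversion.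
Proof.
by apply/measurable_fun_pairP; split; rewrite /comp/=; meas.
Qed.

Lemma integral_inversion (F : plane -> R) : measurable_fun setT F ->
  (forall p, 0 <= F p) ->
  (\int[area]_p (F (inversion p) * (p.1 ^+ 2 + p.2 ^+ 2) ^- 2)%:E =
   \int[area]_p (F p)%:E)%E.
Proof.
move=> mF F0.
pose K t := (\int[leb]_x (`|x| * F (x, x * t)%R)%:E)%E.
have mFs : measurable_fun setT (fun p : plane => F (p.1, p.1 * p.2)).
  apply: (measurableT_comp mF); apply/measurable_fun_pairP; split; rewrite /comp/=; meas.
have mK : measurable_fun setT K.
  pose G (p : plane) := (`|p.1| * F (p.1, p.1 * p.2))%:E.
  apply: (@measurable_fun_fubini_tonelli_G _ _ _ _ _ leb G).
    by apply: measurable_funEFin; apply: measurable_funM => //; meas.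
  by move=> p; rewrite lee_fin mulr_ge0.
have K0 t : (0 <= K t)%E by apply: integral_ge0 => x _; rewrite lee_fin mulr_ge0.
rewrite [RHS]integral_slope// -/(K _).
have N10 : -1 != 0 :> R by rewrite oppr_eq0 oner_eq0.
(* Inversion carries the line of slope t to the line of slope -t, hence the reflection of the outer
   variable. *)
rewrite -[RHS](integral_scale N10 mK K0) normrN1 mul1e.
rewrite integral_slope; last 2 first.
- apply: measurable_funM; first exact: (measurableT_comp mF measurable_inversion).
  by meas.
- by move=> p; rewrite mulr_ge0// invr_ge0 sqr_ge0.
apply: eq_integral => t _.
pose c := (1 + t ^+ 2)^-1.
have c0 : 0 < c by rewrite invr_gt0 ltr_pwDl// sqr_ge0.
pose g x := `|x| * F (x, - (x * t)).
have mg : measurable_fun setT g.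
  apply: measurable_funM; first by meas.
  apply: (measurableT_comp mF); apply/measurable_fun_pairP; split; rewrite /comp/=; meas.
have g0 x : 0 <= g x by rewrite mulr_ge0.
(* On the line of slope t one has [x^2 + (x t)^2 = x^2 / c], and inversion acts on the first
   coordinate by [x |-> c / x]. The planar weight thus becomes the weight of the one-dimensional
   inversion, up to a dilation by [c]. *)
transitivity (\int[leb]_x (c * g (c * x^-1) * `|x| ^- 2)%:E)%E.
  apply: eq_integral => x _; congr EFin; rewrite /inversion/=.
  have [->|x0] := eqVneq x 0; first by rewrite normr0 mul0r expr0n/= invr0 mulr0.
  have -> : x ^+ 2 + (x * t) ^+ 2 = x ^+ 2 / c by rewrite /c invrK; ring.
  have -> : x / (x ^+ 2 / c) = c / x by field; rewrite x0 gt_eqF.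
  have -> : - (x * t) / (x ^+ 2 / c) = - (c / x * t) by field; rewrite x0 gt_eqF.
  rewrite /g normrM (gtr0_norm c0) normfV.
  have x1 : `|x| != 0 by rewrite normr_eq0.
  have -> : x ^+ 2 = `|x| ^+ 2 by rewrite real_normK ?num_real.
  move: (F _) `|x| x1 => q y y0; field.
  by rewrite y0 gt_eqF.
rewrite (@lebesgue_integral_inv _ (fun x => c * g (c * x)))//; last 2 first.
- by apply: measurable_funM => //; apply: (measurableT_comp mg); meas.
- by move=> x; rewrite mulr_ge0// ltW.
under eq_integral do rewrite EFinM.
rewrite ge0_integralZl_EFin//; last 3 first.
- by move=> y _; rewrite lee_fin.
- by apply: measurable_funEFin; apply: (measurableT_comp mg); meas.
- exact: ltW.
rewrite -[X in X%:E](gtr0_norm c0) (@integral_scale _ c (fun x => (g x)%:E))//.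
- by rewrite /K; apply: eq_integral => x _; rewrite /g mulN1r mulrN.
- by rewrite gt_eqF.
- exact: measurable_funEFin.
Qed.

End plane.

(** * Explicit integrals on the line *)

Section line_integrals.
Context {R : realType}.
Local Notation leb := (@lebesgue_measure R).

Lemma measurable_lt_nat d (T : measurableType d) (f g : T -> R) :
  measurable_fun setT f -> measurable_fun setT g ->
  measurable_fun setT (fun x => (f x < g x)%R%:R : R).
Proof.
move=> mf mg; apply: (@measurableT_comp _ _ _ _ _ _ (fun b : bool => b%:R : R)).
  by move=> _ Y _; rewrite setTI.
exact: measurable_fun_ltr.
Qed.

Lemma integral_lt_nat (f : R -> R) (D : set R) (b : R -> bool) :
  (forall x, D x <-> b x) ->
  (\int[leb]_(x in D) (f x)%:E = \int[leb]_x (f x * (b x)%:R)%:E)%E.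
Proof.
move=> Db; rewrite integral_mkcond; apply: eq_integral => x _.
rewrite /patch; case: ifPn => [|] xD.
  by have /Db -> : D x by [rewrite inE in xD]; rewrite mulr1.
have -> : b x = false by apply/negbTE/negP => /Db /mem_set; rewrite (negbTE xD).
by rewrite mulr0.
Qed.

Lemma integral_even (f : R -> R) : measurable_fun setT f ->
  (forall x, 0 <= f x) -> (forall x, f (- x) = f x) ->
  (\int[leb]_x (f x)%:E = 2%:E * \int[leb]_(x in `]0%R, +oo[) (f x)%:E)%E.
Proof.
move=> mf f0 fN.
rewrite [X in (_ * X)%E](@integral_lt_nat _ _ (fun x => 0 < x)); last first.
  by move=> x; rewrite /= in_itv/= ?andbT.
pose h x : \bar R := (f x * (0 < x)%R%:R)%:E.
have mh : measurable_fun setT h.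
  by apply: measurable_funEFin; apply: measurable_funM => //; apply: measurable_lt_nat; meas.
have h0 x : (0 <= h x)%E by rewrite lee_fin mulr_ge0.
rewrite mule_natl mule2n -[X in (_ + X)%E](integral_scale (c := -1) _ mh h0) ?oppr_eq0 ?oner_eq0//.
rewrite normrN1 mul1e.
have mhN : measurable_fun setT (fun x : R => h (-1 * x)).
  by apply: (measurableT_comp mh); meas.
rewrite -ge0_integralD//.
apply: eq_integral_neq0; [by meas|exact: emeasurable_funD|].
move=> x x0; rewrite /h mulN1r fN -EFinD -mulrDr oppr_gt0.
by move: x0; case: ltgtP => // _ _; rewrite ?addr0 ?add0r ?mulr1.
by move=> x _; exact: h0.
Qed.

Lemma integral_abs_lt (s : R) : 0 <= s ->
  (\int[leb]_x (`|x| * (`|x| < s)%R%:R)%:E = (s ^+ 2)%:E)%E.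
Proof.
rewrite le_eqVlt => /predU1P[<-|s0].
  rewrite expr0n/=; apply: integral0_eq => x _.
  by rewrite ltNge normr_ge0/= mulr0.
have mlt : measurable_fun setT (fun x : R => (`|x| < s)%R%:R : R).
  by apply: measurable_lt_nat; meas.
rewrite integral_even; last 3 first.
- by meas.
- by move=> x; rewrite mulr_ge0.
- by move=> x; rewrite normrN.
rewrite [X in (_ * X)%E](@integral_lt_nat _ _ (fun x => 0 < x)); last first.
  by move=> x; rewrite /= in_itv/= ?andbT.
transitivity (2%:E * \int[leb]_(x in `]0%R, s[) x%:E)%E.
  congr (_ * _)%E.
  rewrite [RHS](@integral_lt_nat _ _ (fun x => 0 < x < s)); last first.
    by move=> x; rewrite /= in_itv/= ?andbT.
  apply: eq_integral => x _; congr EFin.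
  have [x0|x0] := ltP 0 x; last by rewrite !mulr0.
  by rewrite gtr0_norm// mulr1.
rewrite -(@integral_itv_bndoo _ _ _ _ true false); last exact/measurable_EFinP.
pose F (x : R) := x ^+ 2 / 2.
have dF (x : R) : is_derive x 1 F x.
  apply: is_derive_eq. by rewrite /GRing.scale/=; field.
have cF : continuous F.
  by move=> x; apply: differentiable_continuous; apply/derivable1_diffP; apply: ex_derive.
rewrite (@continuous_FTC2 _ (fun x => x) F)//.
- rewrite -EFinB -EFinM; congr EFin; rewrite /F expr0n/=; by field.
- by apply: continuous_subspaceT => x; exact: cvg_id.
- split => [x _||]; first exact: ex_derive.
    by apply: cvg_at_right_filter; exact: cF.
  by apply: cvg_at_left_filter; exact: cF.
- by move=> x _; rewrite derive1E; exact: derive_val.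
Qed.

Lemma integral_inv1Dsqr :
  (\int[leb]_t ((1 + t ^+ 2)^-1)%:E = (pi : R)%:E)%E.
Proof.
rewrite integral_even.
- rewrite integral_itv_obnd_cbnd; last first.
    by apply: (@measurable_funS _ _ _ _ setT) => //; meas.
  by rewrite (@integral0y_oneDsqr R) -EFinM; congr EFin; field.
- by meas.
- by move=> x; rewrite invr_ge0 addr_ge0// sqr_ge0.
- by move=> x; rewrite sqrrN.
Qed.

Lemma integral_invsqrt1Dsqr :
  (\int[leb]_t ((Num.sqrt (1 + t ^+ 2))^-1 * (`|t| < 1)%R%:R)%:E =
   (2 * ln (1 + Num.sqrt 2) : R)%:E)%E.
Proof.
pose s (t : R) := Num.sqrt (1 + t ^+ 2).
have D0 (t : R) : 0 < 1 + t ^+ 2 by rewrite ltr_pwDl// sqr_ge0.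
have s0 t : 0 < s t by rewrite sqrtr_gt0.
have ts (t : R) : 0 < t + s t.
  rewrite -ltrBlDl sub0r (le_lt_trans (ler_norm _))// normrN -sqrtr_sqr.
  by rewrite ltr_sqrt// ltrDr.
have ds (t : R) : is_derive t 1 s (t / s t).
  have h1 : is_derive (1 + t ^+ 2) 1 Num.sqrt (2 * s t)^-1.
    exact: is_derive1_sqrt.
  apply: is_derive_eq. rewrite /GRing.scale/= -/(s _); field. by rewrite gt_eqF.
(* This antiderivative is the inverse hyperbolic sine; [ts] keeps the argument of the logarithm
   positive. *)
pose F t := ln (t + s t).
have dF (t : R) : is_derive t 1 F (s t)^-1.
  have h1 : is_derive (t + s t) 1 (@ln R) (t + s t)^-1 by exact: is_derive1_ln.
  apply: is_derive_eq. rewrite /GRing.scale/=; field. by rewrite !gt_eqF.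
have cF : continuous F.
  by move=> x; apply: differentiable_continuous; apply/derivable1_diffP; apply: ex_derive.
have cs : continuous s.
  by move=> x; apply: differentiable_continuous; apply/derivable1_diffP; apply: ex_derive.
have cV : continuous (fun t => (s t)^-1).
  by move=> x; apply: continuousV; [rewrite gt_eqF|exact: cs].
rewrite -(@integral_lt_nat _ `]-1, 1[%classic); last first.
  by move=> x; rewrite /= in_itv/= ltr_norml.
rewrite -(@integral_itv_bndoo _ _ _ _ true false); last first.
  by apply/measurable_EFinP/measurable_funTS; exact: continuous_measurable_fun.
rewrite (@continuous_FTC2 _ (fun t => (s t)^-1) F)//.
- rewrite -EFinB; congr EFin; rewrite /F /s sqrrN expr1n.
  have -> : (1 + 1 : R) = 2 by [].
  set q := Num.sqrt 2.
  have q2 : q ^+ 2 = 2 by rewrite sqr_sqrtr.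
  have q1 : 1 < q by rewrite -sqrtr1 ltr_sqrt ?ltr1n.
  (* The two endpoints give opposite logarithms because [(q - 1) (q + 1) = 1]. *)
  have -> : -1 + q = (1 + q)^-1.
    by apply: (mulIf (_ : 1 + q != 0)); [lra|rewrite mulVf; [nra|lra]].
  rewrite lnV; last by rewrite posrE; lra.
  ring.
- exact: continuous_subspaceT.
- split => [x _||]; first exact: ex_derive.
    by apply: cvg_at_right_filter; exact: cF.
  by apply: cvg_at_left_filter; exact: cF.
- by move=> x _; rewrite derive1E; exact: derive_val.
Qed.

(** Allows the slopes 1 and -1 to be counted on exactly one side when a square is cut along its
    diagonals. *)
Lemma integral_invsqrt1Dsqr_le :
  (\int[leb]_t ((Num.sqrt (1 + t ^+ 2))^-1 * (`|t| <= 1)%R%:R)%:E =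
   (2 * ln (1 + Num.sqrt 2) : R)%:E)%E.
Proof.
rewrite -integral_invsqrt1Dsqr.
have ms : measurable_fun setT (@Num.sqrt R).
  by apply: continuous_measurable_fun; exact: sqrt_continuous.
have ma : measurable_fun setT (fun t : R => ((Num.sqrt (1 + t ^+ 2))^-1)%:E).
  by apply: measurable_funEFin; apply: measurable_funV; apply: (measurableT_comp ms); meas.
rewrite -(@integral_lt_nat _ `]-1, 1[%classic (fun t => `|t| < 1)); last first.
  by move=> x; rewrite /= in_itv/= ltr_norml.
rewrite -(@integral_lt_nat _ `[-1, 1]%classic (fun t => `|t| <= 1)); last first.
  by move=> x; rewrite /= in_itv/= ler_norml.
by rewrite integral_itv_bndoo//; exact: measurable_funTS.
Qed.

Lemma integral_abs_lt_cst (h : R) : 0 <= h ->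
  (\int[leb]_x ((`|x| < h)%R%:R)%:E = (2 * h)%:E)%E.
Proof.
move=> h0; under eq_integral do rewrite -[X in X%:E]mul1r.
rewrite -(@integral_lt_nat (cst 1) `]-h, h[%classic); last first.
  by move=> x; rewrite /= in_itv/= ltr_norml.
rewrite -[LHS]/(\int[leb]_(x in [set` `](- h)%R, h[]) cst 1%:E x)%E.
rewrite integral_cst//= mul1e lebesgue_measure_itv/= lte_fin.
case: ifPn => [_|]; first by rewrite -EFinB; congr EFin; ring.
by rewrite -leNgt => hh; congr EFin; lra.
Qed.

End line_integrals.

(** * Discs, squares, translations and open sets in the plane *)

Section plane_integrals.
Context {R : realType}.
Local Notation leb := (@lebesgue_measure R).
Local Notation plane := (measurableTypeR R * measurableTypeR R)%type.
Local Notation area := (leb \x leb)%E.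

(** [X] is the squared radius. On the line of slope t the disc is [|x| < sqrt (X / (1 + t^2))],
    where [|x| dx] has mass [X / (1 + t^2)]; the factor [pi] is the integral of [1 / (1 + t^2)]. *)
Lemma integral_disc (X : R) : 0 <= X ->
  (\int[area]_p ((p.1 ^+ 2 + p.2 ^+ 2 < X)%R%:R)%:E = (pi * X)%:E)%E.
Proof.
move=> X0; rewrite integral_slope; last 2 first.
- by apply: measurable_lt_nat; meas.
- by [].
transitivity (\int[leb]_t (X%:E * ((1 + t ^+ 2)^-1)%:E))%E; last first.
  rewrite ge0_integralZl_EFin//; last 2 first.
  - by move=> t _; rewrite lee_fin invr_ge0 addr_ge0// sqr_ge0.
  - by meas.
  by rewrite integral_inv1Dsqr -EFinM mulrC.
apply: eq_integral => t _ /=.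
have D0 : 0 < 1 + t ^+ 2 by rewrite ltr_pwDl// sqr_ge0.
rewrite -EFinM -[X / _]sqr_sqrtr ?divr_ge0// ?ltW//.
rewrite -integral_abs_lt ?sqrtr_ge0//; apply: eq_integral => x _.
congr (_ * _%:R)%:E; congr nat_of_bool.
rewrite -[RHS](ltr_sqr (normr_nneg _) (sqrtr_ge0 _))//.
by rewrite sqr_sqrtr ?divr_ge0// ?ltW// real_normK ?num_real// ltr_pdivlMr//; congr (_ < _); ring.
Qed.

(** In slope coordinates the Jacobian [|x|] cancels the singularity of 1/|p|. What remains is the
    length of the chord: [|x| < r] for slopes up to 1 in modulus, [|x| < r / |t|] beyond. The second
    range gives the integrand [g], which the substitution t -> 1/t turns into the first up to the
    endpoints. *)
Lemma integral_square_inv_norm (r : R) : 0 <= r ->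
  (\int[area]_p ((Num.sqrt (p.1 ^+ 2 + p.2 ^+ 2))^-1 *
     ((`|p.1| < r)%R%:R * (`|p.2| < r)%R%:R))%:E =
   (8 * r * ln (1 + Num.sqrt 2))%:E)%E.
Proof.
move=> r0.
have ms : measurable_fun setT (@Num.sqrt R).
  by apply: continuous_measurable_fun; exact: sqrt_continuous.
rewrite integral_slope; last 2 first.
- apply: measurable_funM.
    by apply: measurable_funV; apply: (measurableT_comp ms); meas.
  by apply: measurable_funM; apply: measurable_lt_nat; meas.
- by move=> p; rewrite !mulr_ge0// invr_ge0 sqrtr_ge0.
pose a (t : R) := (Num.sqrt (1 + t ^+ 2))^-1.
have ma : measurable_fun setT a.
  by apply: measurable_funV; apply: (measurableT_comp ms); meas.
have a0 t : 0 <= a t by rewrite invr_ge0 sqrtr_ge0.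
pose f (t : R) := a t * (`|t| < 1)%R%:R.
pose f1 (t : R) := a t * (`|t| <= 1)%R%:R.
have mf : measurable_fun setT f.
  by apply: measurable_funM => //; apply: measurable_lt_nat; meas.
have f0 t : 0 <= f t by rewrite mulr_ge0.
pose g (t : R) := f t^-1 * `|t| ^- 2.
have mg : measurable_fun setT g.
  apply: measurable_funM; last by meas.
  exact: (measurableT_comp mf (@measurable_invr R)).
have g0 t : 0 <= g t by rewrite mulr_ge0// invr_ge0 sqr_ge0.
have mf1 : measurable_fun setT f1.
  apply: measurable_funM => //.
  apply: (@measurableT_comp _ _ _ _ _ _ (fun b : bool => b%:R : R)).
    by move=> _ Y _; rewrite setTI.
  by apply: measurable_fun_ler; meas.
have f10 t : 0 <= f1 t by rewrite mulr_ge0.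
have gE t : g t = a t * `|t|^-1 * (1 < `|t|)%R%:R.
  have [->|t0] := eqVneq t 0.
    by rewrite /g normr0 expr0n/= invr0 mulr0 ltr10 mulr0.
  have nt0 : 0 < `|t| by rewrite normr_gt0.
  rewrite /g /f normfV invf_lt1// mulrAC; congr (_ * _); rewrite /a.
  have -> : 1 + t^-1 ^+ 2 = (1 + t ^+ 2) / `|t| ^+ 2.
    by rewrite real_normK ?num_real//; field.
  rewrite sqrtrM ?addr_ge0 ?sqr_ge0// sqrtrV ?sqr_ge0// sqrtr_sqr normr_id.
  have : Num.sqrt (1 + t ^+ 2) != 0 by rewrite sqrtr_eq0 -ltNge ltr_pwDl// sqr_ge0.
  by move: (Num.sqrt _) `|t| nt0 => u v v0 u0; field; rewrite u0 gt_eqF.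
have If := @integral_invsqrt1Dsqr R.
have If1 := @integral_invsqrt1Dsqr_le R.
have Ig := lebesgue_integral_inv mf f0.
transitivity (\int[leb]_t ((2 * r)%:E * ((f1 t)%:E + (g t)%:E)))%E; last first.
  rewrite ge0_integralZl_EFin//; last 3 first.
  - by move=> t _; rewrite -EFinD lee_fin addr_ge0.
  - by apply: emeasurable_funD; meas.
  - by rewrite mulr_ge0.
  rewrite ge0_integralD//; last 4 first.
  - by move=> t _; rewrite lee_fin.
  - by meas.
  - by move=> t _; rewrite lee_fin.
  - by meas.
  rewrite Ig If If1 -EFinD -EFinM; congr EFin; ring.
apply: eq_integral => t _.
pose h := if `|t| <= 1 then r else r / `|t|.
have h0 : 0 <= h by rewrite /h; case: ifP => // _; rewrite divr_ge0.
have hE (x : R) : ((`|x| < r) && (`|x * t| < r)) = (`|x| < h).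
  rewrite /h normrM; have [t1|t1] := leP `|t| 1.
    apply/andP/idP => [[]//|xr]; split => //.
    by rewrite (le_lt_trans _ xr)// ler_piMr.
  rewrite ltr_pdivlMr ?(lt_trans _ t1)//.
  apply/andP/idP => [[]//|xr]; split => //.
  by rewrite (le_lt_trans _ xr)// ler_peMr// ltW.
transitivity (\int[leb]_x ((a t)%:E * ((`|x| < h)%R%:R)%:E))%E.
  apply: eq_integral_neq0.
  - apply: measurable_funEFin; apply: measurable_funM; first by meas.
    apply: measurable_funM.
      by apply: measurable_funV; apply: (measurableT_comp ms); meas.
    by apply: measurable_funM; apply: measurable_lt_nat; meas.
  - apply: measurable_funeM; apply: measurable_funEFin.
    by apply: measurable_lt_nat; meas.
  move=> x x0 /=; rewrite -EFinM -hE -mulnb natrM; congr EFin.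
  rewrite [LHS]mulrA; congr (_ * _).
  have -> : x ^+ 2 + (x * t) ^+ 2 = x ^+ 2 * (1 + t ^+ 2) by ring.
  by rewrite sqrtrM ?sqr_ge0// sqrtr_sqr invfM mulrA divff ?mul1r// normr_eq0.
rewrite ge0_integralZl_EFin//; last first.
  by apply: measurable_funEFin; apply: measurable_lt_nat; meas.
rewrite integral_abs_lt_cst// gE -EFinD -!EFinM; congr EFin.
rewrite /h /f1; have [t1|t1] := leP `|t| 1; rewrite mulr1 mulr0 ?addr0 ?add0r.
  by ring.
by field; rewrite gt_eqF// (lt_trans _ t1).
Qed.

Lemma area_translate (a b : R) (A : set plane) : measurable A ->
  area ((fun p => (a + p.1, b + p.2)) @^-1` A) = area A.
Proof.
move=> mA.
have mT : measurable_fun setT (fun p : plane => (a + p.1, b + p.2) : plane).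
  by apply/measurable_fun_pairP; split; rewrite /comp/=; meas.
have [m mE] := image_measure_ex area mT.
suff -> : area A = m A by rewrite mE.
apply: product_measure_unique => // B C mB mC.
rewrite mE /pushforward.
have -> : (fun p => (a + p.1, b + p.2)) @^-1` (B `*` C) =
  (+%R a @^-1` B) `*` (+%R b @^-1` C) by [].
have mt c (D : set R) : measurable D -> measurable (+%R c @^-1` D : set R).
  move=> mD; rewrite -[X in measurable X]setTI.
  have mc : measurable_fun setT (fun x : R => c + x) by meas.
  exact: mc.
apply: (etrans (product_measure1E leb leb (mt a _ mB) (mt b _ mC))).
by congr (_ * _)%E; apply: lebesgue_measure_translate.
Qed.

Lemma integral_translate (a b : R) (D : set plane) (f : plane -> \bar R) :
  measurable D -> measurable_fun D f -> (forall p, 0 <= f p)%E ->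
  (\int[area]_(p in D) f p =
   \int[area]_(p in (fun p => (a + p.1, b + p.2)%R) @^-1` D) f (a + p.1, b + p.2)%R)%E.
Proof.
move=> mD mf f0.
have mT : measurable_fun setT (fun p : plane => (a + p.1, b + p.2) : plane).
  by apply/measurable_fun_pairP; split; rewrite /comp/=; meas.
rewrite -(ge0_integral_pushforward mT area mD mf); last by move=> p _; exact: f0.
have [m mE] := image_measure_ex area mT.
rewrite -mE; apply: eq_measure_integral => A mA _.
by rewrite mE /pushforward; apply/esym; exact: area_translate.
Qed.

(** Squares with rational centres and rational half-sides are countably many, and those contained in
    [A] cover it. *)
Lemma open_measurable2 (A : set plane) :
  (forall p, A p -> exists2 e : R, 0 < e & forall q : plane,
     `|q.1 - p.1| < e -> `|q.2 - p.2| < e -> A q) ->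
  measurable A.
Proof.
move=> oA.
pose box (k : rat * rat * rat) : set plane :=
  `](ratr k.1.1 - ratr k.2), (ratr k.1.1 + ratr k.2)[%classic `*`
  `](ratr k.1.2 - ratr k.2), (ratr k.1.2 + ratr k.2)[%classic.
have -> : A = \bigcup_(k in [set k | box k `<=` A]) box k.
  apply/seteqP; split => [p Ap|p [k kA]]; last exact: kA.
  have [e e0 eA] := oA _ Ap.
  have [q q0 qe] : exists2 q : rat, 0 < ratr q :> R & ratr q < e / 2.
    have e2 : 0 < e / 2 by rewrite divr_gt0.
    have [q] := rat_in_itvoo e2; rewrite in_itv/= => /andP[q0 qe].
    by exists q.
  have near (x : R) : exists2 k : rat, x - ratr q < ratr k & ratr k < x + ratr q.
    have xq : x - ratr q < x + ratr q by rewrite ltrD2l gtrN.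
    have [k] := rat_in_itvoo xq; rewrite in_itv/= => /andP[k0 ke].
    by exists k.
  have [k1 k1l k1u] := near p.1.
  have [k2 k2l k2u] := near p.2.
  exists ((k1, k2), q).
    move=> z [] /=; rewrite !in_itv/= => /andP[z1l z1u] /andP[z2l z2u].
    by apply: eA; rewrite ltr_distl; apply/andP; split; lra.
  by split; rewrite /= in_itv/=; apply/andP; split; lra.
rewrite bigcup_mkcond; apply: countable_bigcupT_measurable => [|k]; first exact: countableP.
by case: ifP => // _; exact: measurableX.
Qed.

End plane_integrals.

(** * Averaging over unit cells *)

Section cells.
Context {R : realType}.
Local Notation leb := (@lebesgue_measure R).
Local Notation plane := (measurableTypeR R * measurableTypeR R)%type.
Local Notation area := (leb \x leb)%E.

Definition half_open (k : int) : set R := `[(k%:~R - 2^-1), (k%:~R + 2^-1)[.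

(** Half-open sides make these squares a partition of the plane; each consists of the points that
    round to the Gaussian integer at its centre. *)
Definition cell (u : int * int) : set plane := half_open u.1 `*` half_open u.2.

Lemma measurable_cell u : measurable (cell u).
Proof. by apply: measurableX; exact: measurable_itv. Qed.

Lemma area_cell u : area (cell u) = 1%E.
Proof.
have h k : leb (half_open k) = 1%E.
  rewrite /half_open lebesgue_measure_itv/= lte_fin ifT; last by lra.
  by rewrite -EFinB; congr EFin; field.
have mh k : measurable (half_open k) by exact: measurable_itv.
apply: (etrans (product_measure1E leb leb (mh _) (mh _))).
by rewrite -[RHS]mule1; congr (_ * _)%E; exact: h.
Qed.

Lemma half_open_uniq (x : R) k l : half_open k x -> half_open l x -> k = l.
Proof.
rewrite /half_open/= !in_itv/= => /andP[k1 k2] /andP[l1 l2].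
have kl : k%:~R < (l + 1)%:~R :> R by rewrite intrD; lra.
have lk : l%:~R < (k + 1)%:~R :> R by rewrite intrD; lra.
rewrite !ltr_int !ltzD1 in kl lk.
by apply/eqP; rewrite eq_le kl lk.
Qed.

Lemma cell_ex (p : plane) : exists u, cell u p.
Proof.
have h (x : R) : half_open (Num.floor (x + 2^-1)) x.
  rewrite /half_open/= in_itv/=.
  have := floor_itv (x + 2^-1); rewrite intrD => /andP[k1 k2].
  by apply/andP; split; lra.
by exists (Num.floor (p.1 + 2^-1), Num.floor (p.2 + 2^-1)); split; exact: h.
Qed.

Let cells (n : nat) : set plane :=
  if pickle_inv n is Some u then cell u else set0.

Let measurable_cells n : measurable (cells n).
Proof. by rewrite /cells; case: pickle_inv => [u|//]; exact: measurable_cell. Qed.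

Let cells_cover : \bigcup_n cells n = setT.
Proof.
apply/seteqP; split => // p _; have [u up] := cell_ex p.
by exists (pickle u); [exact: I|rewrite /cells pickleK_inv; exact: up].
Qed.

Let trivIset_cells : trivIset setT cells.
Proof.
move=> m n _ _ [p []]; rewrite /cells.
case Em : (pickle_inv m) => [u|//]; case En : (pickle_inv n) => [v|//].
move=> [u1 u2] [v1 v2].
have uv : u = v.
  by case: u v u1 u2 v1 v2 {Em En} => [a b] [c d] /= u1 u2 v1 v2;
    rewrite (half_open_uniq u1 v1) (half_open_uniq u2 v2).
have := @pickle_invK (int * int)%type m; have := @pickle_invK (int * int)%type n.
by rewrite Em En uv /= => -> ->.
Qed.

Lemma sigma_finite_area : sigma_finite setT area.
Proof.
exists cells => [//|n]; split => //; rewrite /cells.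
by case: pickle_inv => [u|]; rewrite ?measure0 ?area_cell ?ltry.
Qed.

Lemma le_integral_cells (f g : plane -> \bar R) :
  measurable_fun setT f -> measurable_fun setT g ->
  (forall p, 0 <= f p)%E -> (forall p, 0 <= g p)%E ->
  (forall u, \int[area]_(p in cell u) f p <= \int[area]_(p in cell u) g p)%E ->
  (\int[area]_p f p <= \int[area]_p g p)%E.
Proof.
move=> mf mg f0 g0 fg.
rewrite -cells_cover (ge0_integral_bigcup area measurable_cells _ _ trivIset_cells); last 2 first.
- by rewrite cells_cover.
- by move=> p _; exact: f0.
rewrite (ge0_integral_bigcup area measurable_cells _ _ trivIset_cells); last 2 first.
- by rewrite cells_cover.
- by move=> p _; exact: g0.
apply: lee_nneseries => [n _ _|n _]; first by apply: integral_ge0 => p _; exact: f0.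
by rewrite /cells; case: pickle_inv => [u|]; rewrite ?integral_set0.
Qed.

End cells.

Section averaging.
Context {R : realType}.
Local Notation leb := (@lebesgue_measure R).
Local Notation plane := (measurableTypeR R * measurableTypeR R)%type.
Local Notation area := (leb \x leb)%E.

Definition offset (u : int * int) (w : plane) : plane :=
  (- u.1%:~R + w.1, - u.2%:~R + w.2).

Lemma cell_offset u w : cell u w <-> cell (0, 0) (offset u w).
Proof.
rewrite /cell /half_open /offset/=; split => -[] /=; rewrite !in_itv/= !mulr0z.
  by move=> /andP[? ?] /andP[? ?]; split; apply/andP; split; lra.
by move=> /andP[? ?] /andP[? ?]; split; apply/andP; split; lra.
Qed.

(* The sigma-finite structure has to be packed by hand: the canonical instance on
   product measures requires subprobabilities. *)
Definition sf_area : {sigma_finite_measure set plane -> \bar R} :=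
  HB.pack area (Measure_isSigmaFinite.Build _ _ _ area sigma_finite_area).

Section compare.
Variables (f : plane -> \bar R) (H : plane -> plane -> R).
Hypotheses (mf : measurable_fun setT f) (f0 : forall w, (0 <= f w)%E).
Hypotheses (mH : measurable_fun setT (fun z : plane * plane => H z.1 z.2))
  (H0 : forall w p, 0 <= H w p).

Let G w := (\int[area]_p (H w p)%:E)%E.

Let mHE : measurable_fun setT (fun z : plane * plane => (H z.1 z.2)%:E).
Proof. exact: measurable_funEFin. Qed.

Let HE0 (z : plane * plane) : (0 <= (H z.1 z.2)%:E)%E.
Proof. by rewrite lee_fin. Qed.

Let mG : measurable_fun setT G.
Proof. exact: (@measurable_fun_fubini_tonelli_F _ _ _ _ _ sf_area _ mHE HE0). Qed.

Let G0 w : (0 <= G w)%E.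
Proof. by apply: integral_ge0 => p _; rewrite lee_fin. Qed.

Let mHw w : measurable_fun setT (fun p => (H w p)%:E).
Proof.
have mp : measurable_fun setT (fun p : plane => (w, p)) by apply: measurable_fun_pair.
exact: (measurableT_comp mHE mp).
Qed.

Let GE u w : G w = (\int[area]_p (H w (offset u p))%:E)%E.
Proof. by apply: integral_translate => // p; rewrite lee_fin. Qed.

Let mHo u w : measurable_fun setT (fun p => (H w (offset u p))%:E).
Proof.
have mo : measurable_fun setT (offset u).
  by apply/measurable_fun_pairP; split; rewrite /comp/=; meas.
exact: (measurableT_comp (mHw w) mo).
Qed.

Let integral_G : (\int[area]_w G w = \int[area]_p \int[area]_w (H w p)%:E)%E.
Proof. exact: (@fubini_tonelli _ _ _ _ _ sf_area sf_area _ mHE HE0). Qed.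

Let integral_cell_cst u (c : \bar R) :
  (0 <= c)%E -> (\int[area]_(p in cell u) (cst c p) = c)%E.
Proof.
move=> c0; rewrite integral_cst; last exact: measurable_cell.
by rewrite -[RHS]mule1; congr (_ * _)%E; exact: area_cell.
Qed.

(* The bound holds for every representative [w'] of the cell: integrating over [w']
   in the cell, of area 1, decouples the offset from the position. *)
Lemma integral_le_cell_average :
  (forall u w w', cell u w -> cell u w' -> (f w <= (H w' (offset u w))%:E)%E) ->
  (\int[area]_w f w <= \int[area]_p \int[area]_w (H w p)%:E)%E.
Proof.
move=> fH; rewrite -integral_G.
apply: (le_integral_cells mf mG f0 G0) => u.
have mu := measurable_cell u.
have c0 : (0 <= \int[area]_(p in cell u) f p)%E by exact: integral_ge0.
rewrite -(integral_cell_cst u c0).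
apply: ge0_le_integral.
- exact: mu.
- by move=> p _; exact: c0.
- exact: measurable_cst.
- exact: (measurable_funTS mG).
move=> w' uw' /=; rewrite (GE u).
apply: (@le_trans _ _ (\int[area]_(p in cell u) (H w' (offset u p))%:E)%E).
  apply: ge0_le_integral.
  - exact: mu.
  - by move=> p _; exact: f0.
  - exact: (measurable_funTS mf).
  - exact: (measurable_funTS (mHo u w')).
  - by move=> w uw; exact: fH.
apply: ge0_subset_integral; [exact: mu|exact: measurableT|exact: mHo| |exact: subsetT].
by move=> p _; rewrite lee_fin.
Qed.

(** Since [H w'] is supported on offsets from the central cell, its integral over the whole plane is
    an integral over the cell [u], where the pointwise bound applies; averaging over [w'] in that
    cell of area 1 gives the claim. The order with the offset innermost is the one suited to weights
    whose integral over offsets is the area of a disc. *)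
Lemma cell_integral_le_integral :
  (forall w p, ~ cell (0, 0) p -> H w p = 0) ->
  (forall u w w', cell u w -> cell u w' -> ((H w' (offset u w))%:E <= f w)%E) ->
  (\int[area]_w \int[area]_p (H w p)%:E <= \int[area]_w f w)%E.
Proof.
move=> H0' fH; rewrite -[leLHS]/(\int[area]_w G w)%E.
apply: (le_integral_cells mG mf G0 f0) => u.
have mu := measurable_cell u.
have c0 : (0 <= \int[area]_(p in cell u) f p)%E by exact: integral_ge0.
rewrite -[leRHS](integral_cell_cst u c0).
apply: ge0_le_integral.
- exact: mu.
- by move=> p _; exact: G0.
- exact: (measurable_funTS mG).
- exact: measurable_cst.
move=> w' uw' /=; rewrite (GE u).
rewrite (_ : (\int[area]_p _ = \int[area]_(p in cell u) (H w' (offset u p))%:E)%E).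
  apply: ge0_le_integral.
  - exact: mu.
  - by move=> p _; rewrite lee_fin.
  - exact: (measurable_funTS (mHo u w')).
  - exact: (measurable_funTS mf).
  - by move=> w uw; exact: fH.
rewrite [RHS]integral_mkcond; apply: eq_integral => p _; rewrite /patch.
case: ifPn; first by [].
move=> /negP; rewrite inE => pu; rewrite H0'; first by [].
by move=> /(cell_offset u p).2; exact: pu.
Qed.

Lemma cell_average_le_integral :
  (forall w p, ~ cell (0, 0) p -> H w p = 0) ->
  (forall u w w', cell u w -> cell u w' -> ((H w' (offset u w))%:E <= f w)%E) ->
  (\int[area]_p \int[area]_w (H w p)%:E <= \int[area]_w f w)%E.
Proof. by move=> H0' fH; rewrite -integral_G; exact: cell_integral_le_integral. Qed.

End compare.
End averaging.

(** * Averages of the weight |w|^-4 over offsets *)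

Section weights_upper.
Context {R : realType}.
Local Notation leb := (@lebesgue_measure R).
Local Notation plane := (measurableTypeR R * measurableTypeR R)%type.
Local Notation area := (leb \x leb)%E.

Definition sqn (p : plane) : R := p.1 ^+ 2 + p.2 ^+ 2.

Lemma sqn_ge0 p : 0 <= sqn p. Proof. by rewrite addr_ge0 ?sqr_ge0. Qed.

Lemma measurable_sqn : measurable_fun setT sqn.
Proof. by rewrite /sqn; meas. Qed.

Lemma sqn_inversion w : sqn (inversion w) = (sqn w)^-1.
Proof.
rewrite /sqn /inversion /=; set n := w.1 ^+ 2 + w.2 ^+ 2.
have [->|n0] := eqVneq n 0; first by rewrite invr0 !mulr0 !expr0n addr0.
by rewrite !exprMn sqrrN -mulrDl -/n; field.
Qed.

(** Inversion turns the exterior of a disc with weight |w|^-4 into a disc with weight 1, of squared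
    radius [a / sqrt s]. With [s = |p|^2] this produces the factor 1/|p|. *)
Lemma integral_inversion_tail (a s : R) : 0 < a -> 0 < s ->
  (\int[area]_w ((s < a ^+ 2 * sqn w ^+ 2)%R%:R * sqn w ^- 2)%:E =
   (pi * (a / Num.sqrt s))%:E)%E.
Proof.
move=> a0 s0.
have q0 : 0 < Num.sqrt s by rewrite sqrtr_gt0.
pose F (z : plane) : R := (sqn z < a / Num.sqrt s)%R%:R.
have mF : measurable_fun setT F.
  by apply: measurable_lt_nat; [exact: measurable_sqn|meas].
transitivity (\int[area]_z (F z)%:E)%E; last first.
  by apply: integral_disc; rewrite divr_ge0// ltW.
rewrite -integral_inversion//.
apply: eq_integral => w _; rewrite -/(sqn w) /F sqn_inversion; congr EFin.
have := sqn_ge0 w; rewrite le_eqVlt => /predU1P[<-|w0].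
  by rewrite expr0n/= invr0 !mulr0.
congr (_%:R * _); congr nat_of_bool.
rewrite ltr_pdivlMr// (mulrC _^-1) ltr_pdivrMr// -exprMn.
rewrite -[RHS]ltr_sqr ?nnegrE ?(ltW q0)// ?mulr_ge0 ?ltW//.
by rewrite sqr_sqrtr// ltW.
Qed.

Lemma eq_integral_plane_neq0 (F G : plane -> \bar R) :
  measurable_fun setT F -> measurable_fun setT G ->
  (forall p, 0 <= F p)%E -> (forall p, 0 <= G p)%E ->
  (forall p, p.1 != 0 -> F p = G p) ->
  (\int[area]_p F p = \int[area]_p G p)%E.
Proof.
move=> mF mG F0 G0 FG.
rewrite (fubini_tonelli1 _ mF F0) (fubini_tonelli1 _ mG G0).
apply: eq_integral_neq0 => [||x x0].
- exact: (@measurable_fun_fubini_tonelli_F _ _ _ _ _ leb _ mF F0).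
- exact: (@measurable_fun_fubini_tonelli_F _ _ _ _ _ leb _ mG G0).
- by apply: eq_integral => y _; exact: FG.
Qed.

Definition in_square (s : R) (p : plane) : R :=
  (`|p.1| < s)%R%:R * (`|p.2| < s)%R%:R.

Lemma measurable_in_square s : measurable_fun setT (in_square s).
Proof. by apply: measurable_funM; apply: measurable_lt_nat; meas. Qed.

Lemma in_square_ge0 s p : 0 <= in_square s p.
Proof. by rewrite mulr_ge0. Qed.

Lemma in_squareE s p : in_square s p = ((`|p.1| < s) && (`|p.2| < s))%R%:R.
Proof. by rewrite /in_square -natrM mulnb. Qed.

Lemma cell0_norm p : cell (0, 0) p -> `|p.1| <= 2^-1 :> R /\ `|p.2| <= 2^-1 :> R.
Proof.
rewrite /cell /half_open/= => -[] /=; rewrite !in_itv/= !mulr0z !add0r.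
by move=> /andP[? ?] /andP[? ?]; rewrite !ler_norml; split; apply/andP; split; lra.
Qed.

Lemma cell0_in_square s p : 2^-1 < s -> cell (0, 0) p -> in_square s p = 1.
Proof.
move=> s2 /cell0_norm[p1 p2].
by rewrite in_squareE (le_lt_trans p1)// (le_lt_trans p2).
Qed.

Lemma in_square_cell0 p : ~ cell (0, 0) p -> in_square 2^-1 p = 0.
Proof.
move=> Np; rewrite in_squareE; case: (boolP (_ && _)) => [/andP[p1 p2]|//].
exfalso; apply: Np.
rewrite /cell /half_open/=; split => /=; rewrite in_itv/= mulr0z add0r.
  by move: p1; rewrite ltr_norml => /andP[? ?]; apply/andP; split; lra.
by move: p2; rewrite ltr_norml => /andP[? ?]; apply/andP; split; lra.
Qed.

Lemma measurable_inv_norm :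
  measurable_fun setT (fun p => (Num.sqrt (sqn p))^-1 : R).
Proof.
have ms : measurable_fun setT (@Num.sqrt R).
  by apply: continuous_measurable_fun; exact: sqrt_continuous.
by apply: measurable_funV; apply: (measurableT_comp ms); exact: measurable_sqn.
Qed.

Lemma integral_in_square (k s : R) : 0 <= k -> 0 <= s ->
  (\int[area]_p (k * ((Num.sqrt (sqn p))^-1 * in_square s p))%:E =
   (k * (8 * s * ln (1 + Num.sqrt 2)))%:E)%E.
Proof.
move=> k0 s0; under eq_integral do rewrite EFinM.
rewrite ge0_integralZl_EFin//.
- by rewrite (integral_square_inv_norm s0) EFinM.
- by move=> p _; rewrite lee_fin mulr_ge0 ?invr_ge0 ?sqrtr_ge0 ?in_square_ge0.
- apply: measurable_funEFin; apply: measurable_funM; last exact: measurable_in_square.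
  exact: measurable_inv_norm.
Qed.

(** For a fixed offset p the integral over w is [pi a / |p|], which is then integrated over an open
    square. Taking [s > 1/2] makes that square contain the half-open cell, boundary included. *)
Lemma cell_average_upper (f : plane -> \bar R) (a k s : R) :
  measurable_fun setT f -> (forall w, 0 <= f w)%E ->
  0 < a -> 0 <= k -> 2^-1 < s ->
  (forall u w w', cell u w -> cell u w' -> (f w <=
    (k * ((sqn (offset u w) < a ^+ 2 * sqn w' ^+ 2)%R%:R * sqn w' ^- 2))%:E)%E) ->
  (\int[area]_w f w <= (k * pi * a * (8 * s * ln (1 + Num.sqrt 2)))%:E)%E.
Proof.
move=> mf f0 a0 k0 s2 fk.
pose H (w p : plane) : R :=
  k * in_square s p * ((sqn p < a ^+ 2 * sqn w ^+ 2)%R%:R * sqn w ^- 2).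
have ms1 : measurable_fun setT (fun z : plane * plane => sqn z.1).
  by apply: (measurableT_comp measurable_sqn); meas.
have ms2 : measurable_fun setT (fun z : plane * plane => sqn z.2).
  by apply: (measurableT_comp measurable_sqn); meas.
have mH : measurable_fun setT (fun z : plane * plane => H z.1 z.2).
  apply: measurable_funM.
    by apply: measurable_funM; [meas|apply: (measurableT_comp (measurable_in_square s)); meas].
  by apply: measurable_funM; [apply: measurable_lt_nat|]; meas.
have H0 w p : 0 <= H w p by rewrite !mulr_ge0 ?invr_ge0 ?sqr_ge0.
have h2 := integral_le_cell_average mf f0 mH H0.
apply: le_trans (h2 _) _.
  move=> u w w' uw uw'; rewrite (le_trans (fk _ _ _ uw uw'))// lee_fin.
  by rewrite /H cell0_in_square// ?mulr1//; exact: (cell_offset u w).1.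
rewrite -integral_in_square; last 2 first.
- by rewrite !mulr_ge0 ?pi_ge0// ltW.
- by rewrite (le_trans _ (ltW s2)).
rewrite le_eqVlt; apply/orP; left; apply/eqP.
have mHE : measurable_fun setT (fun z : plane * plane => (H z.1 z.2)%:E).
  exact: measurable_funEFin.
(* The null line [p.1 = 0] is left out: at the origin the integral over w diverges, whereas the
   formula takes the default value 0. *)
apply: eq_integral_plane_neq0.
- have HE0 (z : plane * plane) : (0 <= (H z.1 z.2)%:E)%E by rewrite lee_fin.
  exact: (@measurable_fun_fubini_tonelli_G _ _ _ _ _ sf_area _ mHE HE0).
- apply: measurable_funEFin; apply: measurable_funM; first by meas.
  apply: measurable_funM; last exact: measurable_in_square.
  exact: measurable_inv_norm.
- by move=> p; apply: integral_ge0 => w _; rewrite lee_fin.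
- by move=> p; rewrite lee_fin !mulr_ge0 ?invr_ge0 ?sqrtr_ge0 ?pi_ge0// ltW.
move=> p p0.
have sp : 0 < sqn p by rewrite ltr_pwDl ?sqr_ge0// lt_neqAle sqr_ge0 eq_sym sqrf_eq0 p0.
under eq_integral do rewrite /H EFinM.
rewrite ge0_integralZl_EFin//.
- by rewrite integral_inversion_tail// -EFinM; congr EFin; ring.
- by move=> w _; rewrite lee_fin mulr_ge0 ?invr_ge0 ?sqr_ge0.
- have := measurable_sqn => mq; apply: measurable_funEFin; apply: measurable_funM; last by meas.
  by apply: measurable_lt_nat; meas.
- by rewrite mulr_ge0 ?in_square_ge0.
Qed.

End weights_upper.

Section weights_lower.
Context {R : realType}.
Local Notation leb := (@lebesgue_measure R).
Local Notation plane := (measurableTypeR R * measurableTypeR R)%type.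
Local Notation area := (leb \x leb)%E.

(** The cut-off [M < |w|^2] is free for offsets outside the square of half-side [M b]: there |p| >=
    M b, and |p| < b|w|^2 already implies it. Discarding the offsets inside that square replaces
    [1/2] by [1/2 - M b]. *)
Lemma cell_average_lower (f : plane -> \bar R) (b k M : R) :
  measurable_fun setT f -> (forall w, 0 <= f w)%E ->
  0 < b -> 0 <= k -> 0 <= M -> M * b <= 2^-1 ->
  (forall u w w', cell u w -> cell u w' ->
    ((k * ((sqn (offset u w) < b ^+ 2 * sqn w' ^+ 2)%R%:R * (M < sqn w')%R%:R *
       sqn w' ^- 2))%:E <= f w)%E) ->
  ((k * pi * b * (8 * (2^-1 - M * b) * ln (1 + Num.sqrt 2)))%:E <=
   \int[area]_w f w)%E.
Proof.
move=> mf f0 b0 k0 M0 Mb fk.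
set r := M * b.
have r0 : 0 <= r by rewrite mulr_ge0// ltW.
pose H (w p : plane) : R :=
  k * in_square 2^-1 p * ((sqn p < b ^+ 2 * sqn w ^+ 2)%R%:R *
    (M < sqn w)%R%:R * sqn w ^- 2).
have ms1 : measurable_fun setT (fun z : plane * plane => sqn z.1).
  by apply: (measurableT_comp measurable_sqn); meas.
have ms2 : measurable_fun setT (fun z : plane * plane => sqn z.2).
  by apply: (measurableT_comp measurable_sqn); meas.
have mH : measurable_fun setT (fun z : plane * plane => H z.1 z.2).
  apply: measurable_funM.
    by apply: measurable_funM; [meas|apply: (measurableT_comp (measurable_in_square _)); meas].
  by do 2 (apply: measurable_funM; [|meas]); apply: measurable_lt_nat; meas.
have H0 w p : 0 <= H w p by rewrite !mulr_ge0 ?invr_ge0 ?sqr_ge0.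
apply: le_trans (cell_average_le_integral mf f0 mH H0 _ _); last 2 first.
- by move=> w p Np; rewrite /H in_square_cell0// mulr0 mul0r.
- move=> u w w' uw uw'; apply: le_trans (fk _ _ _ uw uw'); rewrite lee_fin /H.
  rewrite -[leLHS]mulrA ler_wpM2l// ler_piMl ?mulr_ge0 ?invr_ge0 ?sqr_ge0//.
  by rewrite in_squareE lern1 leq_b1.
have kpb : 0 <= k * pi * b by rewrite !mulr_ge0 ?pi_ge0// ltW.
have HE0 (z : plane * plane) : (0 <= (H z.1 z.2)%:E)%E by rewrite lee_fin.
have mHE : measurable_fun setT (fun z : plane * plane => (H z.1 z.2)%:E).
  exact: measurable_funEFin.
have rsq p : in_square r p <= in_square 2^-1 p.
  rewrite !in_squareE ler_nat; case: (boolP (_ && _)) => // /andP[p1 p2].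
  by rewrite (lt_le_trans p1)// (lt_le_trans p2).
pose D p := k * pi * b * ((Num.sqrt (sqn p))^-1 * (in_square 2^-1 p - in_square r p)).
have D0 p : 0 <= D p.
  by rewrite !mulr_ge0 ?invr_ge0 ?sqrtr_ge0 ?pi_ge0 ?subr_ge0 ?rsq// ltW.
pose E p := k * pi * b * ((Num.sqrt (sqn p))^-1 * in_square r p).
have E0 p : 0 <= E p.
  by rewrite !mulr_ge0 ?invr_ge0 ?sqrtr_ge0 ?pi_ge0 ?in_square_ge0// ltW.
have mq (s : R) := measurable_in_square s.
have mD : measurable_fun setT D.
  apply: measurable_funM; first by meas.
  by apply: measurable_funM; [exact: measurable_inv_norm|apply: measurable_funB].
have mE : measurable_fun setT E.
  apply: measurable_funM; first by meas.
  by apply: measurable_funM; first exact: measurable_inv_norm.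
have ID : (\int[area]_p (D p)%:E + \int[area]_p (E p)%:E =
   (k * pi * b * (8 * 2^-1 * ln (1 + Num.sqrt 2)))%:E)%E.
  rewrite -ge0_integralD//; last 4 first.
  - by move=> p _; rewrite lee_fin.
  - exact: measurable_funEFin.
  - by move=> p _; rewrite lee_fin.
  - exact: measurable_funEFin.
  rewrite -integral_in_square ?invr_ge0//; apply: eq_integral => p _.
  by rewrite -EFinD /D /E; congr EFin; ring.
rewrite (integral_in_square kpb r0) in ID.
have -> : ((k * pi * b * (8 * (2^-1 - r) * ln (1 + Num.sqrt 2)))%:E =
    \int[area]_p (D p)%:E)%E.
  case: (\int[area]_p (D p)%:E)%E ID => [d||]//; rewrite -EFinD => -[] ID.
  by congr EFin; rewrite mulrBr mulrBl mulrBr -ID addrK.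
apply: ge0_le_integral => //.
- by move=> p _; rewrite lee_fin.
- exact: measurable_funEFin.
- exact: (@measurable_fun_fubini_tonelli_G _ _ _ _ _ sf_area _ mHE HE0).
move=> p _.
(* At [p = 0] the default value [0^-1 = 0] makes [D p] vanish, and the bound is trivial. *)
have := sqn_ge0 p; rewrite le_eqVlt => /predU1P[sp|sp].
  by rewrite /D -sp sqrtr0 invr0 mul0r mulr0; apply: integral_ge0 => w _; rewrite lee_fin.
have [pr|pr] := boolP ((`|p.1| < r) && (`|p.2| < r)).
  have e1 : in_square r p = 1 by rewrite in_squareE pr.
  have e2 : in_square 2^-1 p = 1.
    have h1 : in_square 2^-1 p <= 1 :> R by rewrite in_squareE lern1 leq_b1.
    have h2 : 1 <= in_square 2^-1 p :> R by rewrite -[leLHS]e1.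
    by apply/le_anti; rewrite h1 h2.
  by rewrite /D e1 e2 subrr !mulr0; apply: integral_ge0 => w _; rewrite lee_fin.
rewrite /D (_ : in_square r p = 0) ?in_squareE ?(negbTE pr)// subr0 -in_squareE.
rewrite le_eqVlt; apply/orP; left; apply/eqP/esym.
transitivity (\int[area]_w ((k * in_square 2^-1 p)%:E *
    ((sqn p < b ^+ 2 * sqn w ^+ 2)%R%:R * sqn w ^- 2)%:E))%E.
  apply: eq_integral => w _; rewrite /H -EFinM; congr (_ * (_ * _))%:E.
  have [sw|] := ltP (sqn p) (b ^+ 2 * sqn w ^+ 2); last by rewrite mul0r.
  suff -> : M < sqn w by rewrite mulr1.
  have rs : r ^+ 2 <= sqn p.
    rewrite negb_and -!leNgt in pr; rewrite /sqn.
    rewrite -(real_normK (num_real p.1)) -(real_normK (num_real p.2)).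
    by case/orP: pr => pr; [rewrite ler_wpDr|rewrite ler_wpDl];
      rewrite ?sqr_ge0// ler_sqr ?nnegrE.
  have := le_lt_trans rs sw; rewrite /r -exprMn ltr_sqr ?nnegrE//; last first.
    by rewrite mulr_ge0 ?sqn_ge0// ltW.
  by rewrite mulrC ltr_pM2l.
rewrite ge0_integralZl_EFin//.
- by rewrite integral_inversion_tail// -EFinM; congr EFin; ring.
- by move=> w _; rewrite lee_fin mulr_ge0 ?invr_ge0 ?sqr_ge0.
- have := measurable_sqn => mq'; apply: measurable_funEFin; apply: measurable_funM; last by meas.
  by apply: measurable_lt_nat; meas.
- by rewrite mulr_ge0 ?in_square_ge0.
Qed.

End weights_lower.

Local Open Scope complex_scope.

(** * Complex moduli and neighbourhoods *)

Section modulus.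
Context {R : realType}.
Local Notation leb := (@lebesgue_measure R).
Local Notation plane := (measurableTypeR R * measurableTypeR R)%type.
Local Notation area := (leb \x leb)%E.
Implicit Types (z w : R[i]).

Definition cabs (z : R[i]) : R := Num.sqrt (complex.Re z ^+ 2 + complex.Im z ^+ 2).

Lemma normE z : `|z| = (cabs z)%:C.
Proof. exact: normc_def. Qed.

Lemma cabs_ge0 z : 0 <= cabs z. Proof. exact: sqrtr_ge0. Qed.

Lemma cabs_sqr z : cabs z ^+ 2 = complex.Re z ^+ 2 + complex.Im z ^+ 2.
Proof. by rewrite sqr_sqrtr// addr_ge0 ?sqr_ge0. Qed.

Lemma cabsD z w : cabs (z + w) <= cabs z + cabs w.
Proof. by rewrite -lecR rmorphD/= -!normE ler_normD. Qed.

Lemma cabsN z : cabs (- z) = cabs z.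
Proof. by apply: complexI; rewrite -!normE normrN. Qed.

Lemma cabsB z w : cabs (z - w) = cabs (w - z).
Proof. by rewrite -opprB cabsN. Qed.

Lemma cabs_dist z w : cabs z <= cabs w + cabs (z - w).
Proof. by rewrite -[z in leLHS](subrK w) addrC cabsD. Qed.

Lemma cabsM z w : cabs (z * w) = cabs z * cabs w.
Proof. by apply: complexI; rewrite rmorphM/= -!normE normrM. Qed.

Lemma cabsV z : cabs z^-1 = (cabs z)^-1.
Proof. by apply: complexI; rewrite -normE normfV normE fmorphV. Qed.

Lemma cabs0 : cabs 0 = 0 :> R.
Proof. by apply: complexI; rewrite -normE normr0. Qed.

Lemma cabs_eq0 z : (cabs z == 0) = (z == 0).
Proof. by rewrite -[RHS]normr_eq0 normE -(inj_eq (@complexI R)). Qed.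

Lemma cabs_gt0 z : (0 < cabs z) = (z != 0).
Proof. by rewrite lt_neqAle cabs_ge0 andbT eq_sym cabs_eq0. Qed.

Lemma cabs_le_coords z (a b : R) :
  `|complex.Re z| <= a -> `|complex.Im z| <= b -> cabs z <= a + b.
Proof.
move=> za zb; have a0 := le_trans (normr_ge0 _) za; have b0 := le_trans (normr_ge0 _) zb.
rewrite -[leRHS]ger0_norm ?addr_ge0// -sqrtr_sqr ler_sqrt ?sqr_ge0//.
rewrite -(real_normK (num_real (complex.Re z))) -(real_normK (num_real (complex.Im z))).
rewrite sqrrD; apply: lerD; last by rewrite ler_sqr ?nnegrE.
by rewrite ler_wpDr ?mulrn_wge0 ?mulr_ge0// ler_sqr ?nnegrE.
Qed.

Lemma inv_dist z w : z != 0 -> w != 0 ->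
  cabs (z^-1 - w^-1) = cabs (z - w) / (cabs z * cabs w).
Proof.
move=> z0 w0; have -> : z^-1 - w^-1 = (w - z) / (z * w) by field; rewrite z0 w0.
by rewrite cabsM cabsV cabsM cabsB.
Qed.

Definition toC (p : plane) : R[i] := p.1 +i* p.2.

Lemma sqn_toC p : sqn p = cabs (toC p) ^+ 2.
Proof. by rewrite cabs_sqr. Qed.

Lemma toC_inversion p : toC (inversion p) = (toC p)^-1.
Proof. by rewrite /toC/inversion/= mulNr. Qed.

Definition gz (u : int * int) : R[i] := u.1%:~R +i* u.2%:~R.

Lemma gaussianP z : gaussian_integers z <-> exists u, z = gz u.
Proof.
by split=> [[a [b ->]]|[[a b] ->]]; [exists (a, b)|exists a, b].
Qed.

Lemma toC_offset u (w : plane) : toC (offset u w) = toC w - gz u.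
Proof. by rewrite /toC /offset /gz/=; apply/eqP; rewrite eq_complex/= ![- _ + _]addrC !eqxx. Qed.

Lemma cell_coords u (w : plane) : cell u w ->
  `|complex.Re (toC w - gz u)| <= 2^-1 /\ `|complex.Im (toC w - gz u)| <= 2^-1.
Proof. by move=> /cell_offset/cell0_norm; rewrite -toC_offset. Qed.

Lemma cell_dist_le1 u (w : plane) : cell u w -> cabs (toC w - gz u) <= 1.
Proof.
move=> /cell_coords[h1 h2]; apply: le_trans (cabs_le_coords h1 h2) _; lra.
Qed.

Lemma cell_dist2 u (w w' : plane) : cell u w -> cell u w' -> cabs (toC w) <= cabs (toC w') + 2.
Proof.
move=> uw uw'; have h1 := cell_dist_le1 uw; have h2 := cell_dist_le1 uw'.
have h3 := cabs_dist (toC w) (gz u); have h4 := cabs_dist (gz u) (toC w').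
rewrite cabsB in h4; lra.
Qed.

Lemma int_nearest (x : R) (a b : int) : `|x - a%:~R| <= 2^-1 -> `|x - a%:~R| <= `|x - b%:~R|.
Proof.
move=> xa; have [->//|ab] := eqVneq a b.
have : 1 <= `|a%:~R - b%:~R| :> R.
  by rewrite -intrB -intr_norm ler1z -gtz0_ge1 normr_gt0 subr_eq0.
have := ler_distD x a%:~R b%:~R; rewrite (distrC a%:~R x) => h1 h2; lra.
Qed.

Lemma cell_nearest u (w : plane) v : cell u w -> cabs (toC w - gz u) <= cabs (toC w - gz v).
Proof.
move=> /cell_coords[h1 h2]; rewrite ler_sqrt ?addr_ge0 ?sqr_ge0//.
rewrite -(real_normK (num_real (complex.Re (toC w - gz u)))).
rewrite -(real_normK (num_real (complex.Im (toC w - gz u)))).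
rewrite -(real_normK (num_real (complex.Re (toC w - gz v)))).
rewrite -(real_normK (num_real (complex.Im (toC w - gz v)))).
by apply: lerD; rewrite ler_sqr ?nnegrE//; exact: int_nearest.
Qed.

Lemma in_neighborhood (A : set R[i]) (r : R) y :
  neighborhood A r y <-> exists2 x, A x & cabs (x - y) < r.
Proof. by split => -[x Ax xy]; exists x => //; move: xy; rewrite normE ltcR. Qed.

Definition nbhd_plane (A : set R[i]) (r : R) : set plane :=
  [set p | neighborhood A r (toC p)].

Lemma planar_nbhd A r : planar_lebesgue (neighborhood A r) = area (nbhd_plane A r).
Proof. by []. Qed.

Lemma measurable_nbhd_plane A r : measurable (nbhd_plane A r).
Proof.
apply: open_measurable2 => p /in_neighborhood[x Ax xp].
exists ((r - cabs (x - toC p)) / 2); first by rewrite divr_gt0// subr_gt0.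
move=> q q1 q2; apply/in_neighborhood; exists x => //.
have := cabs_dist (x - toC q) (x - toC p).
have -> : x - toC q - (x - toC p) = toC p - toC q by ring.
have := @cabs_le_coords (toC p - toC q) _ _ (lexx _) (lexx _) => /=.
rewrite -[p.1 - q.1]opprB -[p.2 - q.2]opprB !normrN.
lra.
Qed.

Lemma area_inversion (A : set plane) : measurable A ->
  area A = (\int[area]_p (\1_A (inversion p) * sqn p ^- 2)%:E)%E.
Proof.
move=> mA; rewrite (@integral_inversion _ (\1_A)); last 2 first.
- exact: measurable_indic.
- by move=> p; rewrite indicE.
by rewrite integral_indic// setIT.
Qed.

Lemma measurable_inversion_weight (A : set plane) : measurable A ->
  measurable_fun setT (fun w : plane => (\1_A (inversion w) * sqn w ^- 2 : R)%:E).
Proof.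
move=> mA; apply: measurable_funEFin; apply: measurable_funM.
  by apply: (measurableT_comp _ (@measurable_inversion R)); exact: measurable_indic.
by apply: measurable_funV; apply: measurable_funX; exact: measurable_sqn.
Qed.

End modulus.

(** * Neighbourhoods of the reciprocals of Gaussian integers *)

Section reciprocals_upper.
Context {R : realType}.
Local Notation leb := (@lebesgue_measure R).
Local Notation plane := (measurableTypeR R * measurableTypeR R)%type.
Local Notation area := (leb \x leb)%E.

(** The two useful thresholds are [K = 1], which gives the reciprocals of all nonzero Gaussian
    integers, and [K = 3], which gives a subset of both first-level sets. *)
Definition recip (K : R) : set R[i] :=
  [set z | exists2 u, K <= cabs (gz u) & z = (gz u)^-1].

(** Closeness of 1/w to 1/v means |w - v| < r|v||w|, and the centre u of the cell is at least as
    close to w as v is. One factor [1 + h] pays for |v| against |w|, two more for |w|^2 against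
    |w'|^2. Since |w| > K/2 and |w| and |w'| differ by at most 2, the bound [4 / h + 4 <= K] ensures
    that both are at least 2/h. *)
Lemma recip_nbhd_far (h K r : R) u (w w' : plane) :
  0 < h -> 4 / h + 4 <= K -> 0 < r -> r <= K^-1 -> r <= (h / (1 + h)) ^+ 2 ->
  cell u w -> cell u w' -> toC w != 0 -> neighborhood (recip K) r (toC w)^-1 ->
  [/\ cabs (toC w - gz u) < (1 + h) ^+ 3 * r * cabs (toC w') ^+ 2,
      0 < cabs (toC w') & cabs (toC w') <= (1 + h) * cabs (toC w)].
Proof.
move=> h0 Kh r0 rK rd uw uw' w0 /in_neighborhood[_ [v Kv ->]] vw.
have h4 : 0 < 4 / h by rewrite divr_gt0.
have K0 : 0 < K by lra.
have gv0 : gz v != 0 :> R[i] by rewrite -cabs_gt0; lra.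
have V0 : 0 < cabs (gz v) :> R by rewrite cabs_gt0.
have W0 : 0 < cabs (toC w) by rewrite cabs_gt0.
have wv1 : (cabs (toC w))^-1 < 2 / K.
  have := cabs_dist (toC w)^-1 (gz v)^-1; rewrite cabsB !cabsV.
  have : (cabs (gz v))^-1 <= K^-1 by rewrite lef_pV2 ?posrE.
  have -> : 2 / K = K^-1 + K^-1 by field; lra.
  lra.
have WK : K / 2 < cabs (toC w).
  by move: wv1; rewrite -[2 / K]invf_div ltf_pV2 ?posrE// divr_gt0.
rewrite inv_dist// ltr_pdivrMr ?mulr_gt0// in vw.
have ud := cell_nearest v uw; have d1 := cell_dist_le1 uw.
have VW := cabs_dist (gz v) (toC w).
have W'2 := cell_dist2 uw uw'; have W2 := cell_dist2 uw' uw.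
rewrite [leRHS]cabsB in ud.
move: (cabs (toC w)) (cabs (toC w')) (cabs (gz v)) (cabs (gz v - toC w))
  (cabs (toC w - gz u)) => W W' V D d in V0 W0 WK vw ud d1 VW W'2 W2 *.
have hW : 2 <= h * W.
  have : h * (4 / h + 4) <= h * K by rewrite ler_pM2l.
  have -> : h * (4 / h + 4) = 4 + 4 * h by field; lra.
  nra.
have hW' : 2 <= h * W'.
  have : h * (4 / h + 4) <= h * K by rewrite ler_pM2l.
  have -> : h * (4 / h + 4) = 4 + 4 * h by field; lra.
  nra.
have W'0 : 0 < W' by rewrite -(pmulr_rgt0 _ h0); lra.
have WW' : W <= (1 + h) * W' by rewrite mulrDl mul1r; lra.
split => //; last by rewrite mulrDl mul1r; lra.
have h1 : 0 < 1 + h by lra.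
suff dW : d < (1 + h) * r * W ^+ 2.
  apply: (lt_le_trans dW).
  have e : W ^+ 2 <= ((1 + h) * W') ^+ 2.
    by rewrite ler_sqr ?nnegrE ?mulr_ge0 // ltW.
  rewrite (_ : _ ^+ 3 * r * _ = (1 + h) * r * ((1 + h) * W') ^+ 2); last by ring.
  by rewrite ler_pM2l ?mulr_gt0.
(* If [r W] is small, then V <= W + D with D < r V W gives V < (1 + h) W. Otherwise the upper bound
   on [r] gives [r < (r W)^2], that is [1 < r W^2], and the trivial bound [d <= 1] on the offset is
   enough. *)
have [rW|rW] := leP (r * W) (h / (1 + h)).
  have VW' : V < (1 + h) * W.
    have : V * (1 - h / (1 + h)) < W.
      have : V * (h / (1 + h) - r * W) >= 0 by rewrite mulr_ge0 ?subr_ge0 ?(ltW V0).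
      nra.
    have -> : 1 - h / (1 + h) = (1 + h)^-1 by field; lra.
    by rewrite ltr_pdivrMr// mulrC.
  apply: (le_lt_trans ud); apply: (lt_le_trans vw).
  rewrite (_ : _ * W ^+ 2 = r * ((1 + h) * W * W)); last by ring.
  by rewrite ler_pM2l// ler_pM2r// ltW.
apply: (le_lt_trans d1).
have dW : (h / (1 + h)) ^+ 2 < (r * W) ^+ 2.
  by rewrite ltr_sqr ?nnegrE ?mulr_ge0 ?invr_ge0 ?(ltW h0) ?(ltW h1) ?(ltW r0) ?(ltW W0).
have : r < (r * W) ^+ 2 by exact: le_lt_trans dW.
rewrite exprMn -{1}[r]mulr1 expr2 -mulrA ltr_pM2l// => rW2.
apply: (lt_le_trans rW2); rewrite -mulrA ler_peMl ?mulr_ge0 ?sqr_ge0 ?ltW//; lra.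
Qed.

(** The exponent 8 is 3 for the radius, 4 for replacing the weight |w|^-4 by |w'|^-4, and 1 for
    enlarging the half-side 1/2 of the square to (1 + h)/2. *)
Lemma area_recip_upper (h K r : R) :
  0 < h -> 4 / h + 4 <= K -> 0 < r -> r <= K^-1 -> r <= (h / (1 + h)) ^+ 2 ->
  (area (nbhd_plane (recip K) r) <=
   ((1 + h) ^+ 8 * (4 * pi * ln (1 + Num.sqrt 2)) * r)%:E)%E.
Proof.
move=> h0 Kh r0 rK rd.
have h1 : 0 < 1 + h by lra.
set A := nbhd_plane _ _; have mA : measurable A by exact: measurable_nbhd_plane.
rewrite area_inversion//.
apply: le_trans (@cell_average_upper _ _ ((1 + h) ^+ 3 * r) ((1 + h) ^+ 4)
  ((1 + h) / 2) _ _ _ _ _ _) _.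
- exact: measurable_inversion_weight.
- by move=> w; rewrite lee_fin mulr_ge0 ?invr_ge0 ?sqr_ge0// indicE.
- by rewrite mulr_gt0// exprn_gt0.
- by rewrite exprn_ge0// ltW.
- lra.
- move=> u w w' uw uw'; rewrite lee_fin indicE.
  have [Aw|_] := boolP (inversion w \in A); last first.
    by rewrite mul0r mulr_ge0 ?exprn_ge0 ?(ltW h1)// mulr_ge0// invr_ge0 sqr_ge0.
  have [w0|w0] := eqVneq (toC w) 0.
    rewrite [sqn w]sqn_toC w0 cabs0 !expr0n/= invr0 mulr0.
    by rewrite mulr_ge0 ?exprn_ge0 ?(ltW h1)// mulr_ge0// invr_ge0 sqr_ge0.
  rewrite inE /A /nbhd_plane/= toC_inversion in Aw.
  have [dw W'0 WW'] := recip_nbhd_far h0 Kh r0 rK rd uw uw' w0 Aw.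
  have W0 : 0 < cabs (toC w) by rewrite cabs_gt0.
  rewrite !sqn_toC toC_offset -!exprM mul1r.
  have W'4 : 0 < cabs (toC w') ^+ (2 * 2) by rewrite exprn_gt0.
  have W4 : 0 < cabs (toC w) ^+ (2 * 2) by rewrite exprn_gt0.
  have -> : cabs (toC w - gz u) ^+ 2 < ((1 + h) ^+ 3 * r) ^+ 2 * cabs (toC w') ^+ (2 * 2).
    rewrite exprM -exprMn ltr_sqr ?nnegrE ?cabs_ge0//.
    by rewrite !mulr_ge0 ?exprn_ge0 ?ltW.
  rewrite mul1r ler_pdivlMr// mulrC ler_pdivrMr//.
  have e : cabs (toC w') ^+ (2 * 2) <= ((1 + h) * cabs (toC w)) ^+ (2 * 2).
    by rewrite lerXn2r ?nnegrE ?mulr_ge0 ?cabs_ge0// ltW.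
  by rewrite exprMn in e.
- rewrite lee_fin le_eqVlt; apply/orP; left; apply/eqP; by field.
Qed.

End reciprocals_upper.

Section reciprocals_lower.
Context {R : realType}.
Local Notation leb := (@lebesgue_measure R).
Local Notation plane := (measurableTypeR R * measurableTypeR R)%type.
Local Notation area := (leb \x leb)%E.

(** The centre of the cell itself is the witness. The factor [(1 + h)^3] absorbs |w'|^2 against
    |w|^2 and one |w| against |u|; a large |w'| also gives |u| >= 3. *)
Lemma recip_nbhd_near (h r : R) u (w w' : plane) :
  0 < h -> h <= 1 -> 0 < r -> cell u w -> cell u w' ->
  4 / h + 4 < cabs (toC w') ->
  cabs (toC w - gz u) < r / (1 + h) ^+ 3 * cabs (toC w') ^+ 2 ->
  [/\ neighborhood (recip 3) r (toC w)^-1, toC w != 0 &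
      cabs (toC w) <= (1 + h) * cabs (toC w')].
Proof.
move=> h0 h1 r0 uw uw' Kw' dw'.
have h4 : 0 < 4 / h by rewrite divr_gt0.
have W'2 := cell_dist2 uw uw'; have W2 := cell_dist2 uw' uw.
have d1 := cell_dist_le1 uw.
have uW := cabs_dist (toC w) (gz u).
have h0' : 0 < 1 + h by lra.
have hK : 4 + 4 * h < h * cabs (toC w').
  have : h * (4 / h + 4) < h * cabs (toC w') by rewrite ltr_pM2l.
  by have -> : h * (4 / h + 4) = 4 + 4 * h by field; lra.
have h41 : 4 <= 4 / h by rewrite ler_pdivlMr// ler_piMr.
have W0 : 0 < cabs (toC w) by lra.
have U0 : 0 < cabs (gz u) :> R by lra.
have w0 : toC w != 0 by rewrite -cabs_gt0.
have u0 : gz u != 0 :> R[i] by rewrite -cabs_gt0.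
split => //; last by nra.
apply/in_neighborhood; exists (gz u)^-1; first by exists u => //; lra.
rewrite inv_dist// ltr_pdivrMr ?mulr_gt0// cabsB.
apply: (lt_le_trans dw'); rewrite -mulrA ler_pM2l//.
rewrite ler_pdivrMl ?exprn_gt0//.
have e1 : cabs (toC w) <= (1 + h) * cabs (gz u) by nra.
have e2 : cabs (toC w') <= (1 + h) * cabs (toC w) by nra.
have W'0 : 0 <= cabs (toC w') by exact: cabs_ge0.
have e3 : cabs (toC w') ^+ 2 <= ((1 + h) * cabs (toC w)) ^+ 2.
  by rewrite ler_sqr ?nnegrE// mulr_ge0// ltW.
apply: (le_trans e3).
rewrite (_ : _ * (_ * _) = (1 + h) ^+ 2 * (((1 + h) * cabs (gz u)) * cabs (toC w))); last by ring.
by rewrite exprMn ler_pM2l ?exprn_gt0// expr2 ler_pM2r.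
Qed.

(** The exponent 7 is 3 for the radius and 4 for the weight. The factor [1 - 2 K^2 r], with
    [K = 4 / h + 4], is the price of the cut-off |w| > K. *)
Lemma area_recip_lower (h r : R) :
  0 < h -> h <= 1 -> 0 < r -> (4 / h + 4) ^+ 2 * r <= 2^-1 ->
  (((1 + h) ^- 7 * (1 - 2 * ((4 / h + 4) ^+ 2 * r)) *
     (4 * pi * ln (1 + Num.sqrt 2)) * r)%:E <=
   area (nbhd_plane (recip 3) r))%E.
Proof.
move=> h0 h1 r0 Kr.
have h0' : 0 < 1 + h by lra.
set K := 4 / h + 4 in Kr *.
have h4 : 0 < 4 / h by rewrite divr_gt0.
have K0 : 0 < K by rewrite /K; lra.
set A := nbhd_plane _ _; have mA : measurable A by exact: measurable_nbhd_plane.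
rewrite area_inversion//.
have br : r / (1 + h) ^+ 3 <= r.
  by rewrite ler_pdivrMr ?exprn_gt0// ler_peMr ?(ltW r0)// exprn_ege1//; lra.
have b0 : 0 < r / (1 + h) ^+ 3 by rewrite divr_gt0 ?exprn_gt0.
have Kb : K ^+ 2 * (r / (1 + h) ^+ 3) <= K ^+ 2 * r by rewrite ler_wpM2l// sqr_ge0.
apply: le_trans (@cell_average_lower _ _ (r / (1 + h) ^+ 3) ((1 + h) ^- 4)
  (K ^+ 2) _ _ _ _ _ _ _).
- rewrite lee_fin.
  have L0 : 0 <= ln (1 + Num.sqrt 2) :> R.
    by rewrite ln_ge0// lerDl sqrtr_ge0.
  have e : 0 <= (1 + h) ^- 7 * r * (8 * pi * ln (1 + Num.sqrt 2)).
    by rewrite !mulr_ge0 ?invr_ge0 ?exprn_ge0 ?pi_ge0// ltW.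
  have := ler_wpM2l e Kb.
  have -> : (1 + h) ^- 4 * pi * (r / (1 + h) ^+ 3) *
      (8 * (2^-1 - K ^+ 2 * (r / (1 + h) ^+ 3)) * ln (1 + Num.sqrt 2))
     = (1 + h) ^- 7 * r * (8 * pi * ln (1 + Num.sqrt 2)) * 2^-1 -
       (1 + h) ^- 7 * r * (8 * pi * ln (1 + Num.sqrt 2)) * (K ^+ 2 * (r / (1 + h) ^+ 3)).
    by field; lra.
  have -> : (1 + h) ^- 7 * (1 - 2 * (K ^+ 2 * r)) * (4 * pi * ln (1 + Num.sqrt 2)) * r
     = (1 + h) ^- 7 * r * (8 * pi * ln (1 + Num.sqrt 2)) * 2^-1 -
       (1 + h) ^- 7 * r * (8 * pi * ln (1 + Num.sqrt 2)) * (K ^+ 2 * r).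
    by field; lra.
  by move=> ?; rewrite lerB.
- exact: measurable_inversion_weight.
- by move=> w; rewrite lee_fin mulr_ge0 ?invr_ge0 ?sqr_ge0// indicE.
- exact: b0.
- by rewrite invr_ge0 exprn_ge0// ltW.
- exact: sqr_ge0.
- by rewrite (le_trans Kb).
- move=> u w w' uw uw'; rewrite lee_fin indicE.
  have R0 : 0 <= (inversion w \in A)%:R * sqn w ^- 2 :> R.
    by rewrite mulr_ge0// invr_ge0 sqr_ge0.
  have [Kw'|] := ltP (K ^+ 2) (sqn w'); last by rewrite mulr0 mul0r mulr0.
  rewrite !sqn_toC toC_offset in Kw' R0 *.
  have [dw'|] := ltP (cabs (toC w - gz u) ^+ 2) _; last by rewrite !mul0r mulr0.
  rewrite ltr_sqr ?nnegrE ?cabs_ge0 ?(ltW K0)// in Kw'.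
  have bW : 0 <= r / (1 + h) ^+ 3 * cabs (toC w') ^+ 2.
    by rewrite mulr_ge0 ?sqr_ge0 ?(ltW b0).
  rewrite -exprMn ltr_sqr ?nnegrE ?cabs_ge0 ?bW// in dw'.
  have [Aw w0 WW'] := recip_nbhd_near h0 h1 r0 uw uw' Kw' dw'.
  have -> : inversion w \in A by rewrite inE /A /nbhd_plane/= toC_inversion.
  have W0 : 0 < cabs (toC w) by rewrite cabs_gt0.
  have W'0 : 0 < cabs (toC w') by rewrite (lt_trans K0).
  rewrite !mul1r -invfM lef_pV2 ?posrE ?mulr_gt0 ?exprn_gt0//.
  by rewrite -!exprM -exprMn lerXn2r ?nnegrE ?mulr_ge0 ?cabs_ge0 ?(ltW h0')//.
Qed.

End reciprocals_lower.

(** * Limits at 0 from the right *)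

Section content_limits.
Context {R : realType}.

Lemma cvg_at_right0_fin (g : R -> \bar R) (c : R) :
  (forall e, 0 < e -> \forall r \near 0^'+, ((c - e)%:E <= g r <= (c + e)%:E)%E) ->
  g r @[r --> 0^'+] --> c%:E.
Proof.
move=> gc; apply/fine_cvgP; split.
  near=> r; have : ((c - 1)%:E <= g r <= (c + 1)%:E)%E by near: r; exact: gc.
  move=> /andP[g1 g2]; rewrite fin_numE; apply/andP; split; apply/eqP => gE.
    by rewrite gE in g1.
  by rewrite gE in g2.
apply/cvgrPdist_le => e e0; near=> r.
have : ((c - e)%:E <= g r <= (c + e)%:E)%E by near: r; exact: gc.
rewrite /=; case: (g r) => [x||] /=; rewrite ?leye_eq ?leeNy_eq ?andbF//.
rewrite !lee_fin => /andP[g1 g2]; rewrite ler_distl; apply/andP; split; lra.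
Unshelve. all: by end_near. Qed.

Lemma cvg_at_right0_pinfty (g : R -> \bar R) :
  (forall M, \forall r \near 0^'+, (M%:E <= g r)%E) ->
  g r @[r --> 0^'+] --> +oo%E.
Proof. by move=> gM; apply/cvgeyPge. Qed.

(** A convex function lies below its chord, here over [0, 1]. This makes the distortion linear in
    [h], with constants 127 and 255 for the exponents 7 and 8. *)
Lemma exp1D_le (h : R) n : 0 <= h -> h <= 1 -> (1 + h) ^+ n <= 1 + (2 ^+ n - 1) * h.
Proof.
move=> h0 h1; elim: n => [|n IH]; first by rewrite !expr0 subrr mul0r addr0.
have n1 : 1 <= 2 ^+ n :> R by rewrite exprn_ege1// ler1n.
rewrite !exprS.
have h2 : 0 <= (2 ^+ n - 1) * (h * (1 - h)) by rewrite !mulr_ge0// subr_ge0.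
have h3 : 0 <= 1 + h by lra.
have := ler_wpM2l h3 IH; nra.
Qed.

End content_limits.

(** * The first level *)

Section neighborhoods.
Context {R : realType}.
Local Notation leb := (@lebesgue_measure R).
Local Notation plane := (measurableTypeR R * measurableTypeR R)%type.
Local Notation area := (leb \x leb)%E.

Lemma area_nbhd_le (A B : set R[i]) r :
  A `<=` B -> (area (nbhd_plane A r) <= area (nbhd_plane B r))%E.
Proof.
move=> AB; apply: le_measure; rewrite ?inE; [exact: measurable_nbhd_plane..|].
by move=> p [x Ax xp]; exists x => //; exact: AB.
Qed.

Lemma area_nbhdU (A B : set R[i]) r :
  (area (nbhd_plane (A `|` B) r) <= area (nbhd_plane A r) + area (nbhd_plane B r))%E.
Proof.
have -> : nbhd_plane (A `|` B) r = nbhd_plane A r `|` nbhd_plane B r.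
  apply/seteqP; split => p; first by move=> [x [Ax|Bx] xp]; [left|right]; exists x.
  by move=> [] [x Ax xp]; exists x => //; [left|right].
by apply: measureU2; exact: measurable_nbhd_plane.
Qed.

Lemma area_nbhd1 (x : R[i]) r : 0 < r -> area (nbhd_plane [set x] r) = (pi * r ^+ 2)%:E.
Proof.
move=> r0.
pose D := [set p : plane | sqn p < r ^+ 2].
have tr : nbhd_plane [set x] r =
    (fun p => (- complex.Re x + p.1, - complex.Im x + p.2)) @^-1` D.
  apply/seteqP; split => p /=; rewrite /D/=.
    move=> /in_neighborhood[_ ->]; rewrite cabsB -[X in _ < X](ger0_norm (ltW r0)).
    rewrite -sqrtr_sqr ltr_sqrt ?exprn_gt0//= /sqn/=.
    by rewrite ![- _ + _]addrC; case: x.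
  move=> pr; apply/in_neighborhood; exists x => //.
  rewrite cabsB -[X in _ < X](ger0_norm (ltW r0)) -sqrtr_sqr ltr_sqrt ?exprn_gt0//=.
  by move: pr; rewrite /sqn/= ![- _ + _]addrC; case: x.
have mD : measurable D.
  have mlt : measurable_fun setT (fun p : plane => sqn p < r ^+ 2).
    by apply: measurable_fun_ltr; [exact: measurable_sqn|exact: measurable_cst].
  by rewrite -[D]setTI; exact: (mlt measurableT [set true]).
rewrite tr area_translate//.
rewrite -integral_disc ?sqr_ge0//.
rewrite -(setIT D) -integral_indic//; apply: eq_integral => p _.
by rewrite indicE /D; congr (_%:R)%:E; congr nat_of_bool; apply/idP/idP; rewrite inE.
Qed.

Lemma area_nbhd_seq (s : seq R[i]) r : 0 < r ->
  (area (nbhd_plane [set x | x \in s] r) <= ((size s)%:R * (pi * r ^+ 2))%:E)%E.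
Proof.
move=> r0; elim: s => [|x s IH].
  rewrite (_ : nbhd_plane _ _ = set0) ?measure0 ?lee_fin ?mul0r//.
  by apply/seteqP; split => p // -[].
rewrite (_ : [set y | y \in x :: s] = [set x] `|` [set y | y \in s]); last first.
  apply/seteqP; split => y /=; rewrite inE; first by move=> /orP[/eqP|]; [left|right].
  by move=> [->|->]; rewrite ?eqxx ?orbT.
apply: (le_trans (area_nbhdU _ _ _)); rewrite area_nbhd1//=.
have -> : (size s).+1%:R = (size s)%:R + 1 :> R by rewrite natr1.
by rewrite (mulrDl (size s)%:R) mul1r [leRHS]EFinD addeC leeD.
Qed.

Lemma cabs_ge_Re (z : R[i]) : `|complex.Re z| <= cabs z.
Proof. by rewrite -sqrtr_sqr ler_sqrt ?addr_ge0 ?sqr_ge0// lerDl sqr_ge0. Qed.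

Lemma cabs_ge_Im (z : R[i]) : `|complex.Im z| <= cabs z.
Proof. by rewrite -sqrtr_sqr ler_sqrt ?addr_ge0 ?sqr_ge0// lerDr sqr_ge0. Qed.

Lemma recip_split (K : R) : exists s : seq R[i],
  recip 1 `<=` recip K `|` [set x | x \in s].
Proof.
pose N := Num.bound K.
pose zs := [seq i%:Z | i <- iota 0 N] ++ [seq - i%:Z | i <- iota 0 N].
have mem_zs (a : int) : `|a%:~R| < K -> a \in zs.
  move=> aK.
  have aN : (`|a| < N)%N.
    rewrite -(ltr_nat R) natr_absz intr_norm (lt_trans aK)// archi_boundP//.
    by rewrite (le_trans _ (ltW aK)).
  rewrite mem_cat; have [a0|a0] := leP 0 a.
    by apply/orP; left; apply/mapP; exists `|a|%N; rewrite ?mem_iota ?gez0_abs.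
  by apply/orP; right; apply/mapP; exists `|a|%N; rewrite ?mem_iota// ltz0_abs// opprK.
exists [seq (gz u)^-1 | u <- [seq (a, b) | a <- zs, b <- zs]].
move=> _ [u _ ->]; have [uK|uK] := leP K (cabs (gz u)); [left|right].
  by exists u.
apply/mapP; exists u => //; case: u uK => a b uK.
apply/allpairsP; exists (a, b); split => //; apply: mem_zs; apply: le_lt_trans uK.
  exact: (cabs_ge_Re (gz (a, b))).
exact: (cabs_ge_Im (gz (a, b))).
Qed.

End neighborhoods.

Section first_level.
Context {R : realType}.
Local Notation leb := (@lebesgue_measure R).
Local Notation plane := (measurableTypeR R * measurableTypeR R)%type.
Local Notation area := (leb \x leb)%E.

Lemma near0_le (x : R) : 0 < x -> \forall r \near 0^'+, (r : R) <= x.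
Proof. by move=> x0; near=> r; apply/ltW; near: r; exact: nbhs_right_lt.
Unshelve. all: by end_near. Qed.

Let c : R := 4 * pi * ln (1 + Num.sqrt 2).

Let c0 : 0 <= c.
Proof.
by rewrite !mulr_ge0 ?pi_ge0// ln_ge0// lerDl sqrtr_ge0.
Qed.

Lemma recip_ratio_cvg (A : set R[i]) : recip 3 `<=` A -> A `<=` recip 1 ->
  minkowski_ratio A r @[r --> 0^'+] --> c%:E.
Proof.
move=> A3 A1; apply: cvg_at_right0_fin => e e0.
have c256 : 0 < 2 * (256 * c + 1) by move: c c0 => c' c'0; lra.
(* As 256 exceeds both 127 and 255, distortion costs at most [e / 2]. The other half is spent on the
   finitely many exceptional points in the upper bound and on the cut-off in the lower one; both are
   made small by r once [h], hence [K] and [s], is fixed. *)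
pose h := Num.min 1 (e / (2 * (256 * c + 1))).
have h0 : 0 < h by rewrite lt_min ltr01 divr_gt0.
have h1 : h <= 1 by rewrite ge_min lexx.
have hc : 256 * (h * c) <= e / 2.
  have : h * (2 * (256 * c + 1)) <= e by rewrite -ler_pdivlMr// ge_min lexx orbT.
  have := mulr_ge0 (ltW h0) c0; nra.
have hc0 : 0 <= h * c by rewrite mulr_ge0// ltW.
pose K := 4 / h + 4.
have K0 : 0 < K by rewrite /K ltr_pwDr// divr_ge0// ltW.
have [s sK] := recip_split K.
pose C : R := (size s)%:R * pi.
have C0 : 0 <= C by rewrite mulr_ge0 ?pi_ge0.
near=> r.
have r0 : 0 < r by near: r; exact: nbhs_right_gt.
have rK : r <= K^-1 by near: r; apply: near0_le; rewrite invr_gt0.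
have rh : r <= (h / (1 + h)) ^+ 2.
  by near: r; apply: near0_le; rewrite exprn_gt0// divr_gt0// addr_gt0.
have rC : r <= e / (2 * (C + 1)).
  by near: r; apply: near0_le; rewrite divr_gt0// mulr_gt0// ltr_pwDr.
have rK2 : r <= 2^-1 / K ^+ 2.
  by near: r; apply: near0_le; rewrite divr_gt0// ?invr_gt0// exprn_gt0.
have rc : r <= e / (4 * (K ^+ 2 * c + 1)).
  by near: r; apply: near0_le; rewrite divr_gt0// mulr_gt0// ltr_pwDr// mulr_ge0// sqr_ge0.
rewrite /minkowski_ratio planar_nbhd lee_pdivlMr// lee_pdivrMr//; apply/andP; split.
  apply: le_trans (area_nbhd_le r A3).
  rewrite ler_pdivlMr ?exprn_gt0// mulrC in rK2.
  apply: le_trans (area_recip_lower h0 h1 r0 rK2).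
  rewrite -EFinM lee_fin ler_pM2r// -/c -/K.
  have a0 : 0 < (1 + h) ^+ 7 by rewrite exprn_gt0// addr_gt0.
  rewrite -mulrA ler_pdivlMl//.
  have rc' : 4 * (K ^+ 2 * r * c) + 4 * r <= e.
    have Kc : 0 < 4 * (K ^+ 2 * c + 1).
      by rewrite mulr_gt0// ltr_pwDr// mulr_ge0// sqr_ge0.
    rewrite ler_pdivlMr// in rc; apply: le_trans rc.
    by rewrite le_eqVlt; apply/orP; left; apply/eqP; ring.
  have Krc : 0 <= K ^+ 2 * r * c by rewrite mulr_ge0// mulr_ge0 ?sqr_ge0 ?(ltW r0).
  have a1 := exp1D_le 7 (ltW h0) h1.
  have e7 : 2 ^+ 7 - 1 = 127 :> R by ring.
  rewrite e7 in a1.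
  (* For [c <= e] the left side is not positive; for [c > e] the bound on [(1 + h)^7] may be
     multiplied by [c - e]. *)
  have [ce|ce] := leP c e.
    apply: (@le_trans _ _ 0); first by rewrite mulr_ge0_le0 ?(ltW a0)// subr_le0.
    by rewrite mulr_ge0//; lra.
  have : (1 + h) ^+ 7 * (c - e) <= (1 + 127 * h) * (c - e).
    by rewrite ler_wpM2r// subr_ge0 ltW.
  have : 0 <= h * e by rewrite mulr_ge0// ltW.
  nra.
apply: le_trans (area_nbhd_le r A1) _.
apply: le_trans (area_nbhd_le r sK) _.
apply: le_trans (area_nbhdU _ _ _) _.
apply: le_trans (leeD (area_recip_upper h0 (lexx _) r0 rK rh) (area_nbhd_seq s r0)) _.
rewrite -EFinM -EFinD lee_fin -/c.
have a1 := exp1D_le 8 (ltW h0) h1.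
have e8 : 2 ^+ 8 - 1 = 255 :> R by ring.
rewrite e8 in a1.
have rC' : C * r <= e / 2.
  have C1 : 0 < 2 * (C + 1) by rewrite mulr_gt0// ltr_pwDr.
  rewrite ler_pdivlMr// in rC; nra.
rewrite (_ : _ + _ = ((1 + h) ^+ 8 * c + C * r) * r); last by rewrite /C; ring.
rewrite ler_pM2r//.
have : (1 + h) ^+ 8 * c <= (1 + 255 * h) * c by rewrite ler_wpM2r.
nra.
Unshelve. all: by end_near. Qed.

Lemma gaussian_gz u : @gaussian_integers R (gz u).
Proof. by apply/gaussianP; exists u. Qed.

Lemma gz_ge1 u : gz u != 0 :> R[i] -> 1 <= cabs (gz u) :> R.
Proof.
rewrite eq_complex/= negb_and !intr_eq0 => u0.
have h (a : int) : a != 0 -> 1 <= `|a%:~R : R|.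
  by move=> a0; rewrite -intr_norm ler1z -gtz0_ge1 normr_gt0.
case/orP: u0 => /h h1; apply: (le_trans h1).
  exact: (cabs_ge_Re (gz u)).
exact: (cabs_ge_Im (gz u)).
Qed.

Lemma nearest_gaussianD u (z : R[i]) : unit_square z -> nearest_gaussian (gz u + z) = gz u.
Proof.
move=> uz; have [g1 g2] := nearest_gaussianP (gz u + z).
apply: nearest_gaussian_uniq g1 g2 (gaussian_gz u) _.
by rewrite addrAC subrr add0r.
Qed.

Lemma unit_square_small (z : R[i]) : cabs z < 2^-1 -> unit_square z.
Proof.
move=> z2; have := cabs_ge_Re z; have := cabs_ge_Im z => i1 r1.
have := le_lt_trans i1 z2; have := le_lt_trans r1 z2; rewrite !ltr_norml.
by move=> /andP[? ?] /andP[? ?]; split; apply/andP; split => //; apply: ltW.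
Qed.

(** [v |-> (gz u + v)^-1] is the inverse branch of the Hurwitz map with digit [gz u]. *)
Lemma hurwitz_map_inv u (v : R[i]) : unit_square v -> gz u + v != 0 ->
  hurwitz_map (gz u + v)^-1 = v.
Proof.
move=> uv uv0; rewrite /hurwitz_map invr_eq0 (negbTE uv0) invrK nearest_gaussianD//.
by rewrite addrC addKr.
Qed.

Lemma unit_square0 : unit_square (0 : R[i]).
Proof. by apply: unit_square_small; rewrite cabs0. Qed.

(** For |u| >= 3 the point 1/u has modulus below 1/2, so it lies in the unit square, and rounding u
    leaves remainder 0. *)
Lemma recip3_hurwitz1 : recip 3 `<=` @hurwitz_set R 1.
Proof.
move=> _ [u u3 ->].
have u0 : gz u != 0 :> R[i] by rewrite -cabs_gt0; lra.
split.
- apply: unit_square_small; rewrite cabsV ltf_pV2 ?posrE//; lra.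
- by rewrite /= -[gz u]addr0 hurwitz_map_inv ?addr0//; exact: unit_square0.
- by move=> [|//] _ /=; rewrite invr_eq0.
Qed.

Lemma recip3_G1 : recip 3 `<=` @hurwitz_G R 1.
Proof.
move=> _ [u u3 ->]; exists (gz u), 0; split => //.
- exact: gaussian_gz.
- by rewrite addr0 normE (_ : 1 = 1%:C)// ltcR; lra.
- by rewrite addr0.
Qed.

Lemma hurwitz1_recip1 : @hurwitz_set R 1 `<=` recip 1.
Proof.
move=> z [_ z1 /(_ 0%N isT)/= z0]; move: z1; rewrite /= /hurwitz_map (negbTE z0).
have [/gaussianP[u ->] _] := nearest_gaussianP z^-1.
move=> /eqP; rewrite subr_eq0 => /eqP zu; exists u; last by rewrite -zu invrK.
by apply: gz_ge1; rewrite -zu invr_eq0.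
Qed.

Lemma G1_recip1 : @hurwitz_G R 1 `<=` recip 1.
Proof.
move=> z [_ [_ [/gaussianP[u ->] -> u1 ->]]]; rewrite addr0 in u1 *.
by exists u => //; apply: gz_ge1; rewrite -normr_gt0 (lt_trans _ u1).
Qed.

End first_level.

(** * Higher levels *)

Section fat.
Context {R : realType}.
Local Notation leb := (@lebesgue_measure R).
Local Notation plane := (measurableTypeR R * measurableTypeR R)%type.
Local Notation area := (leb \x leb)%E.

(** This expresses infinite one-dimensional Minkowski content, in a division-free form that passes
    to larger sets and tolerates constant factors. *)
Definition fat (A : set R[i]) : Prop :=
  forall M : R, \forall r \near 0^'+, ((M * r)%:E <= area (nbhd_plane A r))%E.

Lemma fat_cvg (A : set R[i]) : fat A -> minkowski_ratio A r @[r --> 0^'+] --> +oo%E.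
Proof.
move=> fA; apply: cvg_at_right0_pinfty => M; near=> r.
have r0 : 0 < r by near: r; exact: nbhs_right_gt.
by rewrite /minkowski_ratio planar_nbhd lee_pdivlMr// -EFinM; near: r; exact: fA.
Unshelve. all: by end_near. Qed.

Lemma fatS (A B : set R[i]) : A `<=` B -> fat A -> fat B.
Proof.
move=> AB fA M; near=> r; apply: le_trans (area_nbhd_le r AB); near: r; exact: fA.
Unshelve. all: by end_near. Qed.

Definition prepend4 (A : set R[i]) : set R[i] := [set (4%:R + v)^-1 | v in A].

(** For |x| <= 1 and w within r <= 1 of 4 + x, one has |4 + x| >= 3 and 2 <= |w| <= 6. Inversion
    therefore does not increase the distance from w to 4 + x, and its weight |w|^-4 is at least
    [6^-4]; the fatness of [A] is invoked with the constant [M * 6^4] to compensate. *)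
Lemma fat_prepend4 (A : set R[i]) : (forall v, A v -> cabs v <= 1) ->
  fat A -> fat (prepend4 A).
Proof.
move=> A1 fA M; near=> r.
have r0 : 0 < r by near: r; exact: nbhs_right_gt.
have r1 : r <= 1 by near: r; exact: near0_le.
have fr : ((M * 6 ^+ 4 * r)%:E <= area (nbhd_plane A r))%E by near: r; exact: fA.
have mA := measurable_nbhd_plane A r; have mB := measurable_nbhd_plane (prepend4 A) r.
have c4 : cabs (4%:R : R[i]) = 4.
  by rewrite -(rmorph_nat (real_complex R)) /cabs/= expr0n addr0 sqrtr_sqr normr_nat.
pose T (p : plane) : plane := (- 4 + p.1, 0 + p.2).
have mT : measurable_fun setT T.
  by apply/measurable_fun_pairP; split; rewrite /comp/=; meas.
have mTA : measurable (T @^-1` nbhd_plane A r).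
  by rewrite -[X in measurable X]setTI; exact: mT.
rewrite area_inversion//.
apply: (@le_trans _ _ (\int[area]_w ((6 ^- 4)%:E * (\1_(T @^-1` nbhd_plane A r) w)%:E))%E).
  rewrite ge0_integralZl_EFin//; last first.
    by apply: measurable_funEFin; exact: measurable_indic.
  rewrite integral_indic// setIT.
  rewrite [X in (_ * X)%E](_ : _ = area (nbhd_plane A r)); last exact: area_translate.
  by rewrite -lee_pdivrMl ?invr_gt0 ?exprn_gt0// -EFinM invrK mulrA [_ * M]mulrC.
apply: ge0_le_integral => //.
- by apply: measurable_funeM; apply: measurable_funEFin; exact: measurable_indic.
- exact: measurable_inversion_weight.
move=> w _; rewrite -EFinM lee_fin !indicE.
case: (boolP (w \in _)) => [|_]; last by rewrite mulr0 mulr_ge0 ?invr_ge0 ?sqr_ge0.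
rewrite inE /= /nbhd_plane/= => /in_neighborhood[x Ax].
have -> : toC (T w) = toC w - 4%:R.
  rewrite -(rmorph_nat (real_complex R)) /toC /T/=; apply/eqP.
  by rewrite eq_complex/= subr0 add0r addrC !eqxx.
move=> xw; have x1 := A1 _ Ax.
have xw' : cabs ((4%:R + x) - toC w) < r.
  by move: xw; congr (cabs _ < r); ring.
have d1 := cabs_dist (4%:R) (4%:R + x).
rewrite opprD addNKr cabsN c4 in d1.
have d2 := cabs_dist (4%:R + x) (toC w).
have d3 := cabs_dist (toC w) (4%:R + x).
have d4 := cabsD (4%:R) x.
rewrite cabsB in d3; rewrite c4 in d4.
have x0 : 4%:R + x != 0 by rewrite -cabs_gt0; lra.
have w0 : toC w != 0 by rewrite -cabs_gt0; lra.
rewrite (_ : inversion w \in _); last first.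
  rewrite inE /nbhd_plane/= toC_inversion; apply/in_neighborhood.
  exists (4%:R + x)^-1; first by exists x.
  have P : 1 <= cabs (4%:R + x) * cabs (toC w) by rewrite mulr_ege1//; lra.
  by rewrite inv_dist// ltr_pdivrMr ?(lt_le_trans ltr01 P)// (lt_le_trans xw')// ler_peMr ?(ltW r0).
rewrite mulr1 mul1r sqn_toC lef_pV2 ?posrE ?exprn_gt0 ?cabs_gt0//.
rewrite -exprM lerXn2r ?nnegrE ?cabs_ge0//; lra.
Unshelve. all: by end_near. Qed.

End fat.

(** * Discs covered at the second level *)

Section second_level.
Context {R : realType}.
Local Notation leb := (@lebesgue_measure R).
Local Notation plane := (measurableTypeR R * measurableTypeR R)%type.
Local Notation area := (leb \x leb)%E.

Definition second_level : set R[i] :=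
  [set z | exists u v, [/\ 4 <= cabs (gz u) :> R, recip 3 v & z = (gz u + v)^-1]].

(* [e] is only needed at [z = 0], a limit of reciprocals of Gaussian integers. *)
Lemma recip_approx (e : R) (z : R[i]) : 0 < e -> cabs z <= 6^-1 ->
  exists2 v, recip 3 v & cabs v <= 3^-1 /\ cabs (v - z) <= Num.max e (6 / 5 * cabs z ^+ 2).
Proof.
move=> e0 z6.
suff [u u3 uz] : exists2 u, 3 <= cabs (gz u) :> R &
    cabs ((gz u)^-1 - z) <= Num.max e (6 / 5 * cabs z ^+ 2).
  exists (gz u)^-1; first by exists u.
  split => //; rewrite cabsV lef_pV2 ?posrE//; lra.
have [->|z0] := eqVneq z 0.
  pose n := (Num.bound e^-1 + 3)%N.
  have n3 : 3 <= n%:R :> R by rewrite ler_nat /n leq_addl.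
  have cn : cabs (gz (n%:Z, 0)) = n%:R :> R.
    by rewrite /gz /cabs/= expr0n addr0 sqrtr_sqr normr_nat.
  exists (n%:Z, 0); first by rewrite cn.
  rewrite subr0 cabsV cn le_max; apply/orP; left.
  have n0 : 0 < n%:R :> R by lra.
  rewrite invf_ple ?posrE//.
  apply: ltW; apply: lt_le_trans (archi_boundP _) _; first by rewrite invr_ge0 ltW.
  by rewrite ler_nat /n leq_addr.
have z1 : 0 < cabs z by rewrite cabs_gt0.
have zV : 6 <= (cabs z)^-1 by rewrite -[leLHS]invrK lef_pV2 ?posrE ?invr_gt0.
have [u uz] := @cell_ex R (complex.Re z^-1, complex.Im z^-1).
have tz : toC (complex.Re z^-1, complex.Im z^-1) = z^-1 by case: (z^-1).
have := cell_dist_le1 uz; rewrite tz => d1.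
have d2 := cabs_dist z^-1 (gz u); rewrite cabsV in d2.
(* Since |1/z| >= 6, the rounding error, at most 1, is at most a sixth of |1/z|. This yields |u| >=
   5, and the inverse of 5/6 is the factor 6/5 in the bound. *)
have u5 : 5 / 6 * (cabs z)^-1 <= cabs (gz u) by lra.
have u0 : gz u != 0 :> R[i] by rewrite -cabs_gt0; lra.
exists u; first lra.
rewrite le_max; apply/orP; right.
rewrite -[z in X in X <= _]invrK inv_dist ?invr_eq0// cabsV cabsB.
rewrite ler_pdivrMr; last by rewrite mulr_gt0 ?invr_gt0// cabs_gt0.
apply: (le_trans d1).
have -> : 6 / 5 * cabs z ^+ 2 * (cabs (gz u) * (cabs z)^-1) = (6 / 5 * cabs z) * cabs (gz u).
  by field; rewrite gt_eqF.
apply: le_trans (ler_wpM2l _ u5); last by rewrite mulr_ge0// ltW.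
by rewrite le_eqVlt; apply/orP; left; apply/eqP; field; rewrite gt_eqF.
Qed.

(** The offset z = w - u is approximated by a reciprocal v up to max(r, 6/5 |z|^2), and passing to
    inverses divides |v - z| by |u + v||u + z|, which is of order |w'|^2. A bound of order r|w'|^2
    on |z|^2 is therefore sufficient. *)
Lemma second_level_near (r : R) u (w w' : plane) : 0 < r -> r <= 1 ->
  cell u w -> cell u w' -> 6 <= cabs (toC w') ->
  cabs (toC w - gz u) <= 6^-1 ->
  cabs (toC w - gz u) ^+ 2 < r / 8 * cabs (toC w') ^+ 2 ->
  [/\ neighborhood second_level r (toC w)^-1, 0 < cabs (toC w) &
      cabs (toC w) <= 2 * cabs (toC w')].
Proof.
move=> r0 r1 uw uw' w'6 z6 zr.
have W2 := cell_dist2 uw uw'; have W'2 := cell_dist2 uw' uw.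
have du' := cell_dist_le1 uw'; have dW := cabs_dist (toC w') (gz u).
split; [|lra..].
set z := toC w - gz u in z6 zr.
have [v v3 [v1 vz]] := recip_approx r0 z6.
apply/in_neighborhood; exists (gz u + v)^-1.
  by exists u, v; split => //; lra.
have wz : toC w = gz u + z by rewrite /z addrC subrK.
have d1 := cabs_dist (gz u) (gz u + v).
have d2 := cabs_dist (gz u) (gz u + z).
rewrite opprD addNKr cabsN in d1; rewrite opprD addNKr cabsN in d2.
have U : 5 / 6 * cabs (toC w') <= cabs (gz u) by lra.
(* Here |u| >= 5, while |v| <= 1/3 and |z| <= 1/6 are both below |u|/10. The divisor 8 in the
   hypothesis leaves room: 6/5 * 1/8 is less than (9/10)^2 (5/6)^2. *)
have P1 : 9 / 10 * cabs (gz u) <= cabs (gz u + v) by lra.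
have P2 : 9 / 10 * cabs (gz u) <= cabs (gz u + z) by lra.
have a0 : gz u + v != 0 by rewrite -cabs_gt0; lra.
have b0 : gz u + z != 0 by rewrite -cabs_gt0; lra.
rewrite wz inv_dist// ltr_pdivrMr ?mulr_gt0 ?cabs_gt0//.
have -> : gz u + v - (gz u + z) = v - z by ring.
apply: (le_lt_trans vz).
have PP : (9 / 10 * cabs (gz u)) ^+ 2 <= cabs (gz u + v) * cabs (gz u + z).
  by rewrite expr2 ler_pM// mulr_ge0// cabs_ge0.
rewrite gt_max; apply/andP; split.
  rewrite ltr_pMr//; apply: lt_le_trans PP; rewrite exprn_egt1//; lra.
have : r * (9 / 10 * cabs (gz u)) ^+ 2 <= r * (cabs (gz u + v) * cabs (gz u + z)).
  by rewrite ler_pM2l.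
have : r * (5 / 6 * cabs (toC w')) ^+ 2 <= r * cabs (gz u) ^+ 2.
  by rewrite ler_pM2l// ler_sqr ?nnegrE ?mulr_ge0 ?cabs_ge0.
rewrite !exprMn => h1 h2.
have W0 : 0 < r * cabs (toC w') ^+ 2 by rewrite mulr_gt0// exprn_gt0//; lra.
apply: lt_le_trans h2; lra.
Qed.

(** Squared form of the preceding thresholds 6 and 1/6; the factor 1/16 comes from |w| <= 2|w'|
    raised to the fourth power. *)
Lemma second_level_weight (r : R) u (w w' : plane) : 0 < r -> r <= 1 ->
  cell u w -> cell u w' -> 36 <= sqn w' -> sqn (offset u w) < 36^-1 ->
  sqn (offset u w) < r / 8 * sqn w' ->
  neighborhood second_level r (toC w)^-1 /\ 16^-1 * sqn w' ^- 2 <= sqn w ^- 2.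
Proof.
move=> r0 r1 uw uw'; rewrite !sqn_toC toC_offset => wa sp pw.
have w'6 : 6 <= cabs (toC w').
  rewrite -(ler_sqr (_ : 6 \is Num.nneg)) ?nnegrE ?cabs_ge0//; lra.
have z6 : cabs (toC w - gz u) <= 6^-1.
  rewrite -ler_sqr ?nnegrE ?cabs_ge0//; lra.
have [Aw W0 WW'] := second_level_near r0 r1 uw uw' w'6 z6 pw.
have W'0 : 0 < cabs (toC w') by lra.
split=> //; rewrite -invfM lef_pV2 ?posrE ?mulr_gt0 ?exprn_gt0// -!exprM.
have : cabs (toC w) ^+ (2 * 2) <= (2 * cabs (toC w')) ^+ (2 * 2).
  by rewrite lerXn2r ?nnegrE ?mulr_ge0 ?cabs_ge0.
rewrite exprMn => e; lra.
Qed.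

Lemma small_cell0 (p : plane) : sqn p < 36^-1 -> cell (0, 0) p.
Proof.
rewrite sqn_toC => sp.
have p6 : cabs (toC p) < 6^-1 by rewrite -ltr_sqr ?nnegrE ?cabs_ge0//; lra.
have := le_lt_trans (cabs_ge_Re (toC p)) p6; have := le_lt_trans (cabs_ge_Im (toC p)) p6.
rewrite !ltr_norml /cell /half_open/= => /andP[? ?] /andP[? ?].
by split; rewrite /= in_itv/= mulr0z; apply/andP; split; lra.
Qed.

End second_level.

(** * Logarithmic divergence over annuli *)

Section annuli.
Context {R : realType}.
Local Notation leb := (@lebesgue_measure R).
Local Notation plane := (measurableTypeR R * measurableTypeR R)%type.
Local Notation area := (leb \x leb)%E.

(** A difference of indicators of discs: areas follow from [integral_disc] by linearity, and
    consecutive annuli add up by telescoping. *)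
Definition annulus (a b : R) (p : plane) : R :=
  (sqn p < b)%R%:R - (sqn p < a)%R%:R.

Lemma annulusE a b p : a <= b -> annulus a b p = (a <= sqn p < b)%R%:R.
Proof.
move=> ab; rewrite /annulus; have [pa|pa] := ltP (sqn p) a; last by rewrite subr0.
by rewrite (lt_le_trans pa ab) subrr.
Qed.

Lemma annulus_ge0 a b p : a <= b -> 0 <= annulus a b p.
Proof. by move=> ab; rewrite annulusE. Qed.

Lemma measurable_annulus a b : measurable_fun setT (annulus a b).
Proof.
by apply: measurable_funB; apply: measurable_lt_nat => //; exact: measurable_sqn.
Qed.

Lemma integral_annulus a b : 0 <= a -> a <= b ->
  (\int[area]_p (annulus a b p)%:E = (pi * (b - a))%:E)%E.
Proof.
move=> a0 ab; have b0 : 0 <= b by exact: le_trans ab.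
have h : (\int[area]_p (annulus a b p)%:E + (pi * a)%:E = (pi * b)%:E)%E.
  rewrite -!integral_disc// -ge0_integralD//.
  - by apply: eq_integral => p _; rewrite -EFinD subrK.
  - by move=> p _; rewrite lee_fin annulus_ge0.
  - by apply: measurable_funEFin; exact: measurable_annulus.
  - by apply: measurable_funEFin; apply: measurable_lt_nat => //; exact: measurable_sqn.
case: (\int[area]_p _)%E h => [x||]//; rewrite -EFinD => -[] h.
by congr EFin; rewrite mulrBr -h addrK.
Qed.

(** Each step multiplies the squared outer radius by 4. The new annulus has area [3 pi * 36 * 4^n],
    and there 1/|p|^2 is at least [1 / (36 * 4^(n+1))], so it contributes at least [3 pi / 4]
    whatever n is. *)
Lemma integral_annulus_ge n :
  ((n%:R * (pi * 3 / 4))%:E <=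
   \int[area]_p ((sqn p)^-1 * annulus 36 (36 * 4 ^+ n) p)%:E)%E.
Proof.
have n36 k : 36 <= 36 * 4 ^+ k :> R by rewrite ler_peMr// exprn_ege1// ler1n.
have kk k : 36 * 4 ^+ k <= 36 * 4 ^+ k.+1 :> R.
  by rewrite ler_pM2l// exprS ler_peMl ?exprn_ge0// ler1n.
have q0 p : 0 <= (sqn p)^-1 :> R by rewrite invr_ge0 sqn_ge0.
have mq : measurable_fun setT (fun p : plane => (sqn p)^-1 : R).
  by apply: measurable_funV; exact: measurable_sqn.
have ma a b := measurable_annulus a b.
elim: n => [|n IH].
  by rewrite mul0r; apply: integral_ge0 => p _; rewrite lee_fin mulr_ge0// annulus_ge0.
rewrite -natr1 (mulrDl n%:R) mul1r EFinD.
rewrite (_ : (\int[area]_p _)%E = (\int[area]_p ((sqn p)^-1 * annulus 36 (36 * 4 ^+ n) p)%:E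
   + \int[area]_p ((sqn p)^-1 * annulus (36 * 4 ^+ n) (36 * 4 ^+ n.+1) p)%:E)%E); last first.
  rewrite -ge0_integralD//.
  - by apply: eq_integral => p _; rewrite -EFinD -mulrDr /annulus; congr (_ * _)%:E; ring.
  - by move=> p _; rewrite lee_fin mulr_ge0// annulus_ge0.
  - by apply: measurable_funEFin; exact: measurable_funM.
  - by move=> p _; rewrite lee_fin mulr_ge0// annulus_ge0.
  - by apply: measurable_funEFin; exact: measurable_funM.
apply: leeD => //.
have p0 : 0 < 36 * 4 ^+ n.+1 :> R by rewrite mulr_gt0// exprn_gt0.
apply: (@le_trans _ _ (\int[area]_p (((36 * 4 ^+ n.+1)^-1)%:E *
    (annulus (36 * 4 ^+ n) (36 * 4 ^+ n.+1) p)%:E))%E).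
  rewrite ge0_integralZl_EFin//; last 2 first.
  - by move=> p _; rewrite lee_fin annulus_ge0.
  - exact: measurable_funEFin.
  rewrite integral_annulus ?mulr_ge0 ?exprn_ge0// -EFinM lee_fin.
  rewrite le_eqVlt; apply/orP; left; apply/eqP; rewrite exprS.
  have : (4 : R) ^+ n != 0 by rewrite expf_neq0// pnatr_eq0.
  by move=> ?; field.
apply: ge0_le_integral => //.
- by move=> p _; rewrite -EFinM lee_fin mulr_ge0 ?annulus_ge0// invr_ge0 ltW.
- by apply: measurable_funeM; exact: measurable_funEFin.
- by apply: measurable_funEFin; exact: measurable_funM.
move=> p _; rewrite -EFinM lee_fin annulusE//.
case: (boolP (_ <= _ < _)) => [/andP[pa pb]|_]; last by rewrite !mulr0.
rewrite !mulr1 lef_pV2 ?posrE// ?(ltW pb)//.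
by apply: lt_le_trans pa; rewrite mulr_gt0// exprn_gt0.
Qed.

Lemma fat_second_level : fat (@second_level R).
Proof.
move=> M.
(* The integral of [H] over p is [pi r / 128] times |w|^-2 on the annuli, and [n] annuli contribute
   at least [3 n pi / 4]. The product [3 n pi^2 r / 512] exceeds [n k r]. *)
pose k : R := pi ^+ 2 / 256.
have k0 : 0 < k by rewrite divr_gt0 ?exprn_gt0 ?pi_gt0 ?ltr0n.
pose n := Num.bound (`|M| / k).
have nM : M <= n%:R * k.
  rewrite -ler_pdivrMr//; apply: le_trans (ltW (archi_boundP _)).
    by rewrite ler_pM2r ?invr_gt0// ler_norm.
  by rewrite divr_ge0// ltW.
have n36 : 36 <= 36 * 4 ^+ n :> R by rewrite ler_peMr// exprn_ege1// ler1n.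
have N0 : 0 < 36 * 4 ^+ n :> R by rewrite mulr_gt0 ?exprn_gt0.
near=> r.
have r0 : 0 < r by near: r; exact: nbhs_right_gt.
have r1 : r <= 1 by near: r; exact: near0_le.
(* Keeps every disc |p|^2 < r|w|^2 / 8 with w in the annuli inside |p| < 1/6, hence inside the
   central cell and within reach of the approximation by reciprocals. *)
have rN : r <= 8 / 36 / (36 * 4 ^+ n).
  by near: r; apply: near0_le; rewrite !divr_gt0.
set A := nbhd_plane _ _; have mA : measurable A by exact: measurable_nbhd_plane.
rewrite area_inversion//.
pose H (w p : plane) : R := 16^-1 *
  ((sqn p < r / 8 * sqn w)%R%:R * (sqn w ^- 2 * annulus 36 (36 * 4 ^+ n) w)).
have ms1 : measurable_fun setT (fun z : plane * plane => sqn z.1).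
  by apply: (measurableT_comp measurable_sqn); meas.
have ms2 : measurable_fun setT (fun z : plane * plane => sqn z.2).
  by apply: (measurableT_comp measurable_sqn); meas.
have mH : measurable_fun setT (fun z : plane * plane => H z.1 z.2).
  apply: measurable_funM; first by meas.
  apply: measurable_funM; first by apply: measurable_lt_nat; meas.
  apply: measurable_funM; first by meas.
  by apply: (measurableT_comp (measurable_annulus _ _)); meas.
have H0 w p : 0 <= H w p.
  by rewrite !mulr_ge0 ?invr_ge0 ?sqr_ge0 ?annulus_ge0.
have small w p : sqn p < r / 8 * sqn w -> sqn w < 36 * 4 ^+ n -> sqn p < 36^-1.
  move=> pw wN; apply: (lt_le_trans pw).
  apply: (@le_trans _ _ (r / 8 * (36 * 4 ^+ n))).
    by rewrite ler_wpM2l ?ltW// divr_gt0.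
  rewrite ler_pdivlMr// in rN; rewrite mulrAC ler_pdivrMr//.
  by rewrite (le_trans rN)// mulrC.
(* For fixed w the admissible offsets form a full disc, of area [pi r |w|^2 / 8]. Multiplied by the
   weight |w|^-4 this leaves the divergent density |w|^-2. *)
apply: le_trans (@cell_integral_le_integral _ _ H _ _ mH H0 _ _).
- rewrite (_ : (\int[area]_w _)%E = (\int[area]_w ((pi * r / 128)%:E *
      ((sqn w)^-1 * annulus 36 (36 * 4 ^+ n) w)%:E))%E); last first.
    apply: eq_integral => w _.
    transitivity (\int[area]_p ((16^-1 * (sqn w ^- 2 * annulus 36 (36 * 4 ^+ n) w))%:E *
       ((sqn p < r / 8 * sqn w)%R%:R)%:E))%E.
      by apply: eq_integral => p _; rewrite -EFinM /H; congr EFin; ring.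
    rewrite ge0_integralZl_EFin//; last 2 first.
    - apply: measurable_funEFin; apply: measurable_lt_nat => //; exact: measurable_sqn.
    - by rewrite !mulr_ge0 ?invr_ge0 ?sqr_ge0 ?annulus_ge0.
    rewrite integral_disc ?mulr_ge0 ?sqn_ge0 ?divr_ge0 ?(ltW r0)// -!EFinM; congr EFin.
    have [->|w0] := eqVneq (sqn w) 0; first by rewrite expr0n/= invr0 !mul0r !mulr0.
    by field; rewrite w0.
  rewrite ge0_integralZl_EFin//; last 3 first.
  - by move=> w _; rewrite lee_fin mulr_ge0 ?invr_ge0 ?sqn_ge0 ?annulus_ge0.
  - apply: measurable_funEFin; apply: measurable_funM; last exact: measurable_annulus.
    by apply: measurable_funV; exact: measurable_sqn.
  - by rewrite !mulr_ge0 ?pi_ge0 ?invr_ge0// ltW.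
  apply: le_trans (lee_wpmul2l _ (integral_annulus_ge n)); last first.
    by rewrite lee_fin !mulr_ge0 ?pi_ge0 ?invr_ge0// ltW.
  rewrite -EFinM lee_fin.
  apply: (@le_trans _ _ (n%:R * k * r)); first by rewrite ler_pM2r.
  have X0 : 0 <= n%:R * r * pi ^+ 2.
    by rewrite mulr_ge0 ?sqr_ge0// mulr_ge0// ltW.
  rewrite (_ : n%:R * k * r = 1 / 256 * (n%:R * r * pi ^+ 2)); last by rewrite /k; field.
  rewrite [leRHS](_ : _ = 3 / 512 * (n%:R * r * pi ^+ 2)); last by field.
  by apply: ler_wpM2r => //; clear; lra.
- exact: measurable_inversion_weight.
- by move=> w; rewrite lee_fin mulr_ge0 ?invr_ge0 ?sqr_ge0// indicE.
- move=> w p Np; rewrite /H.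
  case: (boolP (sqn p < r / 8 * sqn w)) => [pw|_]; last by rewrite mul0r mulr0.
  rewrite annulusE//; case: (boolP (_ <= _ < _)) => [/andP[wa wb]|_]; last by rewrite !mulr0.
  by case: Np; exact: small_cell0 (small _ _ pw wb).
- move=> u w w' uw uw'; rewrite lee_fin /H indicE.
  have R0 : 0 <= (inversion w \in A)%:R * sqn w ^- 2 :> R.
    by rewrite mulr_ge0// invr_ge0 sqr_ge0.
  case: (boolP (sqn (offset u w) < r / 8 * sqn w')) => [pw|_]; last by rewrite mul0r mulr0.
  rewrite annulusE//; case: (boolP (_ <= _ < _)) => [/andP[wa wb]|_]; last by rewrite !mulr0.
  have [Aw ww'] := second_level_weight r0 r1 uw uw' wa (small _ _ pw wb) pw.
  have -> : inversion w \in A by rewrite inE /A /nbhd_plane/= toC_inversion.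
  by rewrite !mul1r mulr1.
Unshelve. all: by end_near. Qed.

End annuli.

(** * Induction on the level *)

Section higher_levels.
Context {R : realType}.

Lemma unit_square_le1 (v : R[i]) : unit_square v -> cabs v <= 1.
Proof.
case=> /andP[? ?] /andP[? ?].
apply: le_trans (@cabs_le_coords _ v 2^-1 2^-1 _ _) _; last lra.
  by rewrite ler_norml; apply/andP; split; lra.
by rewrite ler_norml; apply/andP; split; lra.
Qed.

(** From |u| >= 4 and |v| <= 1 one gets |u + v| >= 3, so the inverse lies in the unit square. One
    application of the Hurwitz map then returns v, and the rest of the orbit is that of v. *)
Lemma hurwitz_set_prepend m u (v : R[i]) : 4 <= cabs (gz u) :> R ->
  hurwitz_set m v -> hurwitz_set m.+1 (gz u + v)^-1.
Proof.
move=> u4 [sv vm vj].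
have v1 := unit_square_le1 sv.
have d := cabs_dist (gz u) (gz u + v); rewrite opprD addNKr cabsN in d.
have uv0 : gz u + v != 0 by rewrite -cabs_gt0; lra.
split.
- apply: unit_square_small; rewrite cabsV ltf_pV2 ?posrE//; lra.
- by rewrite iterSr hurwitz_map_inv.
- by move=> [_|j jm]; rewrite ?iterSr ?hurwitz_map_inv ?vj//= invr_eq0.
Qed.

Lemma hurwitz_G_prepend m u (v : R[i]) : 4 <= cabs (gz u) :> R -> cabs v <= 1 ->
  hurwitz_G m v -> hurwitz_G m.+1 (gz u + v)^-1.
Proof.
move=> u4 v1 Gv; exists (gz u), v; split => //; first exact: gaussian_gz.
have d := cabs_dist (gz u) (gz u + v); rewrite opprD addNKr cabsN in d.
by rewrite normE (_ : 1 = 1%:C)// ltcR; lra.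
Qed.

(** The condition |u + v| > 1 confines the sets [hurwitz_G] to the unit disc. This plays the part
    that the unit square plays for [hurwitz_set], and it explains why prepending the digit 4 is
    studied on the unit disc. *)
Lemma hurwitz_G_le1 m (v : R[i]) : hurwitz_G m v -> cabs v <= 1.
Proof.
case: m => [->|m [u [w [_ _ uw1 ->]]]]; first by rewrite cabs0.
rewrite normE (_ : 1 = 1%:C)// ltcR in uw1.
by rewrite cabsV invf_le1 ?(lt_trans ltr01)// ltW.
Qed.

Lemma gz4 : gz (4%:Z, 0) = 4%:R :> R[i].
Proof. by rewrite -(rmorph_nat (real_complex R)). Qed.

Lemma cabs_gz4 : cabs (gz (4%:Z, 0)) = 4 :> R.
Proof. by rewrite /cabs/= expr0n addr0 sqrtr_sqr normr_nat. Qed.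

Lemma recip3_le1 (v : R[i]) : recip 3 v -> cabs v <= 1.
Proof. by case=> u u3 ->; rewrite cabsV invf_le1; lra. Qed.

Lemma fat_hurwitz_set m : fat (@hurwitz_set R m.+2).
Proof.
elim: m => [|m IH].
  apply: fatS (@fat_second_level R) => _ [u [v [u4 v3 ->]]].
  by apply: hurwitz_set_prepend => //; exact: recip3_hurwitz1.
apply: fatS (fat_prepend4 _ IH) => [_ [v Hv <-]|v [/unit_square_le1]//].
by rewrite -gz4; apply: hurwitz_set_prepend => //; rewrite cabs_gz4.
Qed.

Lemma fat_hurwitz_G m : fat (@hurwitz_G R m.+2).
Proof.
elim: m => [|m IH].
  apply: fatS (@fat_second_level R) => _ [u [v [u4 v3 ->]]].
  apply: hurwitz_G_prepend => //; [exact: recip3_le1|exact: recip3_G1].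
apply: fatS (fat_prepend4 _ IH) => [_ [v Hv <-]|v]; last exact: hurwitz_G_le1.
by rewrite -gz4; apply: hurwitz_G_prepend (hurwitz_G_le1 Hv) Hv; rewrite cabs_gz4.
Qed.

End higher_levels.
Unset Implicit Arguments.
Local Close Scope complex_scope.
Local Close Scope classical_set_scope.

Theorem theorem1p2 (R : realType) :
  [/\ forall m : nat, (1 <= m)%N ->
        has_minkowski_content (@hurwitz_set R m) /\
        has_minkowski_content (@hurwitz_G R m),
      minkowski_content (@hurwitz_set R 1) =
          (4 * pi * ln (1 + Num.sqrt 2))%:E /\
        minkowski_content (@hurwitz_G R 1) =
          (4 * pi * ln (1 + Num.sqrt 2))%:E
    & forall m : nat, (2 <= m)%N ->
        minkowski_content (@hurwitz_set R m) = +oo%E /\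
        minkowski_content (@hurwitz_G R m) = +oo%E].
Proof.
have H1 := recip_ratio_cvg (@recip3_hurwitz1 R) (@hurwitz1_recip1 R).
have G1 := recip_ratio_cvg (@recip3_G1 R) (@G1_recip1 R).
have Hm m := fat_cvg (@fat_hurwitz_set R m).
have Gm m := fat_cvg (@fat_hurwitz_G R m).
split.
- have c0 : (0 <= (4 * pi * ln (1 + Num.sqrt 2) : R)%:E)%E.
    by rewrite lee_fin !mulr_ge0 ?pi_ge0// ln_ge0// lerDl sqrtr_ge0.
  move=> [//|[|m]] _; split.
  + exists (4 * pi * ln (1 + Num.sqrt 2))%:E; [exact: c0|exact: H1].
  + exists (4 * pi * ln (1 + Num.sqrt 2))%:E; [exact: c0|exact: G1].
  + exists +oo%E; [exact: leey|exact: Hm].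
  + exists +oo%E; [exact: leey|exact: Gm].
- by split; [exact: (cvg_lim (@ereal_hausdorff R) H1)|exact: (cvg_lim (@ereal_hausdorff R) G1)].
- move=> [//|[//|m]] _; split; first exact: (cvg_lim (@ereal_hausdorff R) (Hm m)).
  exact: (cvg_lim (@ereal_hausdorff R) (Gm m)).
Qed.
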